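(* Let $\xi_1\sim IG(\mu_1,\lambda_1)$, $\xi_2\sim IG(\mu_2,\lambda_2)$ and $\eta\sim Exp(1)$ be three independent random variables (with $\mu_1,\lambda_1,\mu_2,\lambda_2>0$). Then the following statements hold: (i) $Z=\xi_1\eta$ is M-det. (ii) $Z=\xi_1\xi_2$ is M-det. (iii) $Z=\xi_1\xi_2\eta$ is M-indet.
   Context: For $\mu,\lambda>0$, $X\sim IG(\mu,\lambda)$ (inverse Gaussian distribution) means that $X$ has density $f(x)=\left(\frac{\lambda}{2\pi x^3}\right)^{1/2}\exp\left[-\frac{\lambda(x-\mu)^2}{2\mu^2x}\right]$ for $x>0$, with $f(0)=0$, and $X$ is nonnegative. $Exp(1)$ is the standard exponential distribution, with density $e^{-x}$ on $[0,\infty)$. A random variable $X$ with distribution function $F$ and moments $m_k=\mathbf{E}[X^k]$ (all finite) is called moment determinate (M-det) if $F$ is the only distribution having the moment sequence $\{m_k\}_{k=1}^\infty$; otherwise it is called moment indeterminate (M-indet). *)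

(* Defs.v *)
From HB Require Import structures.
From mathcomp Require Import all_boot all_order all_algebra.
From mathcomp Require Import all_classical all_reals all_analysis.

Set Implicit Arguments.
Unset Strict Implicit.
Unset Printing Implicit Defensive.

Import Order.TTheory GRing.Theory Num.Theory.
Import numFieldNormedType.Exports.

Local Open Scope classical_set_scope.
Local Open Scope ring_scope.

(* Vanishes on ]-oo, 0]: the distribution is carried by the positive reals. *)
Definition inverse_gaussian_pdf (R : realType) (m l : R) : R -> R :=
  (fun x => Num.sqrt (l / (2 * pi * x ^+ 3)) *
            expR (- (l * (x - m) ^+ 2 / (2 * m ^+ 2 * x)))) \_ `]0, +oo[.

Definition inverse_gaussian_prob (R : realType) (m l : R) (V : set R) : \bar R :=
  (\int[lebesgue_measure]_(x in V) (inverse_gaussian_pdf m l x)%:E)%E.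

Section RandomVariables.
Context (d : measure_display) (T : measurableType d) (R : realType).
Implicit Type P : probability T R.

Definition has_law P (X : {RV P >-> R}) (mu : set R -> \bar R) : Prop :=
  forall A : set R, measurable A -> distribution P X A = mu A.

(* The product rule for two of the variables, hence pairwise independence,
   is the case where the third set is the whole line. *)
Definition independent3 P (X Y Z : {RV P >-> R}) : Prop :=
  forall A B C : set R, measurable A -> measurable B -> measurable C ->
    P (X @^-1` A `&` Y @^-1` B `&` Z @^-1` C) =
    (P (X @^-1` A) * P (Y @^-1` B) * P (Z @^-1` C))%E.

Definition moment P (X : T -> R) (k : nat) : \bar R :=
  ('E_P[fun w => (X w ^+ k)%R])%E.

Definition finite_moments P (X : T -> R) : Prop :=
  forall k : nat, (0 < k)%N -> P.-integrable [set: T] (fun w => (X w ^+ k)%:E).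

End RandomVariables.

Arguments has_law {d T R} P X mu.
Arguments independent3 {d T R} P X Y Z.
Arguments moment {d T R} P X k.
Arguments finite_moments {d T R} P X.

(* The competitors nu are arbitrary probability measures on the whole line;
   the moments of nu are those of the identity random variable under nu.
   Integrability of the first moment makes X measurable, so pushforward P X
   is the distribution of X. *)
Definition moment_determinate (d : measure_display) (T : measurableType d)
    (R : realType) (P : probability T R) (X : T -> R) : Prop :=
  finite_moments P X /\
  forall nu : probability R R,
    finite_moments nu (fun x : R => x) ->
    (forall k : nat, (0 < k)%N -> moment nu (fun x : R => x) k = moment P X k) ->
    forall A : set R, measurable A -> nu A = pushforward P X A.

Arguments moment_determinate {d T R} P X.

(* Finiteness of the moments is a prerequisite of the dichotomy, so it is
   asserted here as well rather than negated. *)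
Definition moment_indeterminate (d : measure_display) (T : measurableType d)
    (R : realType) (P : probability T R) (X : T -> R) : Prop :=
  finite_moments P X /\ ~ moment_determinate P X.

Arguments moment_indeterminate {d T R} P X.

(* Main.v *)
From HB Require Import structures.
Require Import Defs.
From mathcomp Require Import all_boot all_order all_algebra.
From mathcomp Require Import ring lra zify.
From mathcomp Require Import all_classical all_reals all_analysis.
From mathcomp Require Import measurable_realfun.

(** Determinacy of a product of two factors. Let U, V be nonnegative with
exponential moments of some positive order, as are inverse Gaussian and
exponential variables. Since the geometric mean of U and V is at most the
larger of them, exp (c sqrt (U V)) is integrable for a small c > 0
([expR_sqrtM_le]), and this is Hardy's criterion for the Stieltjes problem.
That the competitor may be any distribution nu on the whole line, with the
moments of the law mu of U V, is dealt with by an argument of M. Riesz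
([hardy_determinacy]). For every polynomial D >= 1, the function 1 / D is
approximated by polynomials p so well that the integral of (1 - D p)^2 under mu
is small ([poly_approximable_inv]). This is the integral of a polynomial, so it
is the same under nu; and as |1/D - p| <= |1 - D p|, the integrals of 1 / D
under mu and nu are both close to the common integral of p
([inv_poly_close]). Hence mu and nu integrate all the 1 / D alike, and indicators
of half-lines are bounded limits of such functions ([inv_halfline_cvg]).

The approximation of 1 / D lives in L2 norms with polynomial weights. Cosines
of s sqrt x are power series in x, and for small s their partial sums converge
in these norms because exp (c sqrt x) is integrable. The identity x is a limit
of squares of sin (s sqrt x) / s, which are affine in such a cosine; they are
bounded for each fixed s, so a geometric series gives 1 / D of them, and letting
s go to 0 gives 1 / D.

Indeterminacy of the triple product. Here the natural size of a factor is the
cube root of the product. If W is the product of the two inverse Gaussian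
factors, W times the exponential factor has the density
h x = E [exp (- x / W) / W], and letting both factors of W be of size x^(1/3)
shows h x >= k0 exp (- B x^(1/3)) ([mixture_density_ge]). On the other hand
exp (- u / 2) sin (sqrt 3 / 2 u), the imaginary part of exp (j u) for a primitive
cube root of unity j, taken at u = 2 B x^(1/3), has all its moments equal to zero:
up to a factor the k-th one is the imaginary part of the integral of
u^(3 k + 2) exp (j u), that is, of (3 k + 2)! / (- j)^(3 k + 3), which is real
([osc_cubert_moment]). This function is bounded by exp (- B x^(1/3)), so h can be
perturbed by k0 times it, with either sign: the results are two distinct densities
with the moments of the triple product ([perturbed_moment], [perturbed_neq]),
which therefore cannot be determinate. *)

Set Implicit Arguments.
Unset Strict Implicit.
Unset Printing Implicit Defensive.

Import Order.TTheory GRing.Theory Num.Theory.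
Import numFieldNormedType.Exports.

Local Open Scope classical_set_scope.
Local Open Scope ring_scope.

(** * Polynomial approximation in weighted L2 on the half-line *)

Lemma ler_sqr_norm (R : realDomainType) (a b : R) : `|a| <= `|b| -> a ^+ 2 <= b ^+ 2.
Proof.
move=> ab; rewrite -[leLHS]real_normK ?num_real// -[leRHS]real_normK ?num_real//.
by rewrite ler_sqr ?nnegrE.
Qed.

(** Each multiplication by x spends half of the rate that is left, so that an
arbitrarily small c is enough for every degree. *)
Lemma poly_le_expR_sqrt (R : realType) (p : {poly R}) (c : R) : 0 < c ->
  exists2 K : R, 0 < K & forall x : R, 0 <= x -> `|p.[x]| <= K * expR (c * Num.sqrt x).
Proof.
elim/poly_ind: p c => [|p a IH] c c0.
  by exists 1 => // x _; rewrite horner0 normr0 mul1r expR_ge0.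
have c20 : 0 < c / 2 by rewrite divr_gt0.
have [K K0 HK] := IH _ c20.
exists (K * (2 * (c / 2)^-2) + `|a| + 1); first by rewrite ltr_pwDr// addr_ge0// mulr_ge0 ?ltW// mulr_gt0 ?invr_gt0 ?exprn_gt0.
move=> x x0; rewrite hornerMXaddC.
set y := Num.sqrt x.
have y0 : 0 <= y := sqrtr_ge0 x.
have xy : x = y ^+ 2 by rewrite sqr_sqrtr.
have E1 : 1 <= expR (c * y) by rewrite -expR0 ler_expR mulr_ge0// ltW.
have hx : x <= 2 * (c / 2)^-2 * expR (c / 2 * y).
  have := @expR_ge1Dxn R (c / 2 * y) 1 (mulr_ge0 (ltW c20) y0).
  rewrite exprMn -xy => h.
  rewrite mulrAC -ler_pdivrMr ?invr_gt0 ?exprn_gt0// invrK.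
  by rewrite mulrC; move: h; rewrite (_ : 2`! = 2%N)//; lra.
rewrite (le_trans (ler_normD _ _))// normrM (ger0_norm x0).
have E2 : expR (c * y) = expR (c / 2 * y) * expR (c / 2 * y).
  by rewrite -expRD -mulrDl -splitr.
rewrite -addrA [leRHS]mulrDl lerD//.
  by rewrite E2 mulrACA ler_pM// HK.
by rewrite mulrDl ler_wpDr ?mul1r ?expR_ge0// ler_peMr.
Qed.

Lemma lte_twice_quarters (R : realType) (a b : \bar R) (e : R) :
  (a < (e / 4)%:E -> b < (e / 4)%:E -> 2%:E * a + 2%:E * b < e%:E)%E.
Proof.
move=> ae be; have -> : e%:E = (2%:E * (e / 4)%:E + 2%:E * (e / 4)%:E)%E.
  by rewrite -!EFinM -EFinD; congr EFin; field.
by apply: lteD; rewrite lte_pmul2l.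
Qed.

Section WeightedApproximation.
Context (R : realType) (mu : probability R R).
Local Notation "'R+'" := (`[0%R, +oo[%classic : set R).

(** Kept squared: with D as the weight, the squared distance of 1 / D to p is the
integral of (1 - D p)^2 over the half-line, the quantity on which determinacy
rests. *)
Definition wdist (w : {poly R}) (f g : R -> R) : \bar R :=
  (\int[mu]_(x in R+) ((w.[x] * (f x - g x)) ^+ 2)%:E)%E.

(** Approximation is required for all polynomial weights at once: in a single norm
it would not be stable under products, since the factor p that approximates g in
f g has to be moved into the weight. *)
Definition poly_approximable (f : R -> R) : Prop :=
  measurable_fun setT f /\
  forall (w : {poly R}) (e : R), 0 < e ->
    exists p : {poly R}, (wdist w f (horner p) < e%:E)%E.

Definition weight_dominated (G : R -> R) : Prop :=
  measurable_fun setT G /\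
  forall w : {poly R}, (\int[mu]_(x in R+) ((w.[x] * G x) ^+ 2)%:E < +oo)%E.

Lemma measurable_sqr_weight (w : {poly R}) (f : R -> R) (D : set R) :
  measurable_fun setT f ->
  measurable_fun D (fun x => ((w.[x] * f x) ^+ 2)%:E).
Proof.
move=> mf; apply: measurable_funTS; apply/measurable_EFinP.
by apply: measurable_funX; apply: measurable_funM => //; exact: measurable_poly.
Qed.

Lemma measurable_wdist (w : {poly R}) (f g : R -> R) (D : set R) :
  measurable_fun setT f -> measurable_fun setT g ->
  measurable_fun D (fun x => ((w.[x] * (f x - g x)) ^+ 2)%:E).
Proof.
move=> mf mg.
exact: (@measurable_sqr_weight w (fun x => f x - g x) D (measurable_funB mf mg)).
Qed.

(** For squared distances (a + b)^2 <= 2 a^2 + 2 b^2 stands in for the triangle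
inequality. *)
Lemma wdist_triangle (w : {poly R}) (f g h : R -> R) :
  measurable_fun setT f -> measurable_fun setT g -> measurable_fun setT h ->
  (wdist w f h <= 2%:E * wdist w f g + 2%:E * wdist w g h)%E.
Proof.
move=> mf mg mh; rewrite /wdist.
rewrite -!ge0_integralZl_EFin//; try by [exact: measurable_wdist|
  move=> x _; rewrite lee_fin sqr_ge0].
rewrite -ge0_integralD//; try by [move=> x _; rewrite -EFinM lee_fin mulr_ge0// sqr_ge0|
  apply: measurable_funeM; exact: measurable_wdist].
apply: ge0_le_integral => //.
- by move=> x _; rewrite lee_fin sqr_ge0.
- exact: measurable_wdist.
- by apply: emeasurable_funD; apply: measurable_funeM; exact: measurable_wdist.
- move=> x _; rewrite -!EFinM -EFinD lee_fin.
  set a := w.[x] * (f x - g x); set b := w.[x] * (g x - h x).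
  have -> : w.[x] * (f x - h x) = a + b by rewrite /a /b; ring.
  by rewrite -subr_ge0 (_ : _ - _ = (a - b) ^+ 2) ?sqr_ge0//; ring.
Qed.

Lemma poly_approximable_horner p : poly_approximable (horner p).
Proof.
split; first exact: measurable_poly.
move=> w e e0; exists p; rewrite /wdist (eq_integral (cst 0%E)).
  by rewrite integral0 lte_fin.
by move=> x _ /=; rewrite subrr mulr0 expr0n.
Qed.

Lemma poly_approximable_dominated (f_ : nat -> R -> R) (f G : R -> R) :
  (forall n, poly_approximable (f_ n)) -> measurable_fun setT f ->
  weight_dominated G ->
  (forall n x, 0 <= x -> `|f_ n x - f x| <= G x) ->
  (forall x, 0 <= x -> f_ n x @[n --> \oo] --> f x) ->
  poly_approximable f.
Proof.
move=> Af mf [mG IG] domG cvgf; split => // w e e0.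
have mD : measurable R+ by exact: measurable_itv.
have H : (wdist w f (f_ n) @[n --> \oo] --> \int[mu]_(x in R+) (cst 0 x))%E.
  apply: (dominated_cvg mD (g := fun x => ((w.[x] * G x) ^+ 2)%:E)) => //.
  - by move=> n; apply: measurable_wdist => //; exact: (Af n).1.
  - move=> x; rewrite /= in_itv/= andbT => x0.
    have -> : 0%E = ((w.[x] * (f x - f x)) ^+ 2)%:E :> \bar R.
      by rewrite subrr mulr0 expr0n.
    apply: cvg_EFin; first exact: nearW.
    have h : w.[x] * (f x - f_ n x) @[n --> \oo] --> w.[x] * (f x - f x).
      by apply: cvgM; [exact: cvg_cst|apply: cvgB; [exact: cvg_cst|exact: cvgf]].
    exact: (cvgM h h).
  - apply/integrableP; split; first exact: measurable_sqr_weight.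
    rewrite (eq_integral (fun x => ((w.[x] * G x) ^+ 2)%:E)) ?IG// => x _.
    by rewrite gee0_abs// lee_fin sqr_ge0.
  - move=> n x; rewrite /= in_itv/= andbT => x0.
    rewrite lee_fin (ger0_norm (sqr_ge0 _)) ler_sqr_norm//.
    by rewrite !normrM ler_wpM2l// distrC (le_trans (domG _ _ x0))// ler_norm.
have e4 : 0 < e / 4 by rewrite divr_gt0.
have [n Hn] : exists n, (wdist w f (f_ n) < (e / 4)%:E)%E.
  move: H; rewrite integral0 => /fine_cvgP[[N1 _ F1] H2].
  have /cvgrPdist_lt/(_ _ e4)[N2 _ F2] := H2.
  exists (maxn N1 N2); have := F2 (maxn N1 N2) (leq_maxr _ _).
  have /fineK <- := F1 (maxn N1 N2) (leq_maxl _ _).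
  rewrite /= sub0r normrN lte_fin; apply: le_lt_trans; exact: ler_norm.
have [p Hp] := (Af n).2 w _ e4; exists p.
apply: le_lt_trans; first exact: (wdist_triangle w mf (Af n).1 (@measurable_poly R p setT)).
exact: lte_twice_quarters.
Qed.

Lemma poly_approximableD f g :
  poly_approximable f -> poly_approximable g -> poly_approximable (f \+ g).
Proof.
move=> [mf Af] [mg Ag]; split; first exact: measurable_funD.
move=> w e e0; have e4 : 0 < e / 4 by rewrite divr_gt0.
have [p Hp] := Af w _ e4; have [q Hq] := Ag w _ e4; exists (p + q).
have mp := @measurable_poly R p setT; have mq := @measurable_poly R q setT.
apply: le_lt_trans; first exact: (wdist_triangle w (measurable_funD mf mg)
  (measurable_funD mf mq) (@measurable_poly R (p + q) setT)).
rewrite addeC; apply: lte_twice_quarters.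
  apply: le_lt_trans _ Hp; rewrite /wdist; under eq_integral do rewrite /=.
  by under eq_integral do rewrite hornerD opprD addrACA subrr addr0.
apply: le_lt_trans _ Hq; rewrite /wdist.
by under eq_integral do rewrite /= opprD addrACA subrr add0r.
Qed.

(** The error on g is absorbed by the bound on f; the error on f is then measured
with the weight w p, where p is the approximation of g. *)
Lemma poly_approximableM f g (M : R) : (forall x, 0 <= x -> `|f x| <= M) ->
  poly_approximable f -> poly_approximable g -> poly_approximable (f \* g).
Proof.
move=> fM [mf Af] [mg Ag]; split; first exact: measurable_funM.
have M0 : 0 <= M by rewrite (le_trans _ (fM 0 _)).
move=> w e e0; have e4 : 0 < e / 4 by rewrite divr_gt0.
have e4' : 0 < e / 4 / (M ^+ 2 + 1) by rewrite divr_gt0// ltr_wpDl ?sqr_ge0.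
have [p Hp] := Ag w _ e4'; have [q Hq] := Af (w * p) _ e4; exists (q * p).
have mp := @measurable_poly R p setT; have mq := @measurable_poly R q setT.
apply: le_lt_trans; first exact: (wdist_triangle w (measurable_funM mf mg)
  (measurable_funM mf mp) (@measurable_poly R (q * p) setT)).
apply: lte_twice_quarters; last first.
  apply: le_lt_trans _ Hq; rewrite /wdist.
  rewrite le_eqVlt; apply/orP; left; apply/eqP/eq_integral => x _ /=.
  by rewrite !hornerM; congr EFin; ring.
apply: (@le_lt_trans _ _ ((M ^+ 2)%:E * wdist w g (horner p))%E).
  rewrite /wdist -ge0_integralZl_EFin ?sqr_ge0//; try by [exact: measurable_wdist|
    move=> x _; rewrite lee_fin sqr_ge0].
  apply: ge0_le_integral => //.
  - by move=> x _; rewrite lee_fin sqr_ge0.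
  - by apply: measurable_wdist; apply: measurable_funM.
  - by apply: measurable_funeM; exact: measurable_wdist.
  - move=> x; rewrite /= in_itv/= andbT => x0; rewrite lee_fin.
    rewrite -mulrBr mulrCA exprMn ler_wpM2r ?sqr_ge0//.
    by rewrite ler_sqr_norm// (ger0_norm M0) fM.
have [/eqP M20|M20] := boolP (M ^+ 2 == 0); first by rewrite M20 mul0e lte_fin.
apply: (@lt_trans _ _ ((M ^+ 2)%:E * (e / 4 / (M ^+ 2 + 1))%:E)%E).
  by rewrite lte_pmul2l// lte_fin lt0r M20 sqr_ge0.
rewrite -EFinM lte_fin mulrCA gtr_pMr// ltr_pdivrMr ?mul1r ?ltrDl//.
by rewrite ltr_wpDl ?sqr_ge0.
Qed.

Lemma poly_approximable_comp (p : {poly R}) f (M : R) :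
  (forall x, 0 <= x -> `|f x| <= M) ->
  poly_approximable f -> poly_approximable (horner p \o f).
Proof.
move=> fM Af; have cstA (c : R) : poly_approximable (fun=> c).
  by rewrite (_ : (fun=> c) = horner (c%:P)) ?funeqE; [exact: poly_approximable_horner|move=> x; rewrite hornerC].
elim/poly_ind: p => [|p c IH].
  by rewrite (_ : _ \o _ = fun=> 0); [exact: cstA|rewrite funeqE => x /=; rewrite horner0].
rewrite (_ : _ \o _ = (f \* (horner p \o f)) \+ (fun=> c)).
  by apply: poly_approximableD => //; exact: poly_approximableM fM _ _.
by rewrite funeqE => x /=; rewrite hornerMXaddC mulrC.
Qed.

End WeightedApproximation.

(** * Approximation of the inverse of a polynomial *)

(** The limit is the derivative of sin (y s) in s at 0, along a sequence that goes
to 0. *)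
Lemma cvg_sin_dilation (R : realType) (d y : R) : 0 < d ->
  sin (y * (d / n.+1%:R)) / (d / n.+1%:R) @[n --> \oo] --> y.
Proof.
move=> d0; pose u (n : nat) : R := d / n.+1%:R.
have u_neq0 n : u n != 0 by rewrite gt_eqF// divr_gt0.
have u_cvg0 : u n @[n --> \oo] --> (0 : R).
  rewrite -[X in _ --> X](mulr0 d); apply: cvgM; first exact: cvg_cst.
  exact: cvg_harmonic.
have dsin : is_derive (0 : R) 1 (fun s : R => sin (y * s)) y.
  apply: is_derive_eq.
  by rewrite mulr0 cos0 mul1r; exact: mulr1.
have [+ dE] := dsin; rewrite derivable1_diffP => _.
have := @ex_derive _ _ _ _ _ _ _ dsin; rewrite /derivable /=.
move=> /cvg_ex[l Hl].
have El : l = y.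
  by rewrite -dE /derive; apply/esym/cvg_lim.
move: Hl; rewrite El => /cvgr_dnbhsP /(_ _ (conj u_neq0 u_cvg0)).
apply: cvg_trans; apply: near_eq_cvg; near=> n => /=.
by rewrite mulr0 sin0 subr0 -[_ *: _]/(_ * _) addr0 -[_%:A]/(_ * 1) mulr1 mulrC.
Unshelve. all: by end_near. Qed.

Lemma series_exp_coeff_le (R : realType) (x : R) n :
  0 <= x -> series (exp_coeff x) n <= expR x.
Proof.
move=> x0; rewrite /expR; apply: nondecreasing_cvgn_le.
  apply: nondecreasing_series => k _ _; exact: exp_coeff_ge0.
exact: is_cvg_series_exp_coeff.
Qed.

(** A bound that does not depend on n, for the use of dominated convergence on
partial sums of the cosine series. *)
Lemma norm_series_cos_coeff_le (R : realType) (x : R) n :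
  `|series (cos_coeff' x) n| <= expR `|x|.
Proof.
apply: le_trans (series_exp_coeff_le n.*2 (normr_ge0 x)).
rewrite /series /=; apply: le_trans (ler_norm_sum _ _ _) _.
elim: n => [|n IH]; first by rewrite !big_geq.
rewrite doubleS !big_nat_recr//= -addrA lerD//.
rewrite /cos_coeff' -exprnP !normrM normfV normr_nat !normrX normrN1 expr1n mul1r.
by rewrite lerDl exp_coeff_ge0.
Qed.

Section HardyDensity.
Context (R : realType) (mu : probability R R) (c : R).
Local Notation "'R+'" := (`[0%R, +oo[%classic : set R).
Hypothesis c_gt0 : 0 < c.
Hypothesis exp_sqrt_lty :
  (\int[mu]_(x in R+) (expR (c * Num.sqrt x))%:E < +oo)%E.

Let measurable_sqrt (D : set R) : measurable_fun D (@Num.sqrt R).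
Proof.
by apply: measurable_funTS; apply: continuous_measurable_fun; exact: sqrt_continuous.
Qed.

(** Squaring G uses the rate c / 2; the other half of c absorbs the squared weight. *)
Lemma weight_dominated_expR (G : R -> R) (K : R) : measurable_fun setT G ->
  (forall x, 0 <= x -> `|G x| <= K * expR (c / 4 * Num.sqrt x)) ->
  weight_dominated mu G.
Proof.
move=> mG GK; split => // w.
have K0 : 0 <= K.
  by have := le_trans (normr_ge0 _) (GK 0 (lexx _)); rewrite sqrtr0 mulr0 expR0 mulr1.
have c40 : 0 < c / 4 by rewrite divr_gt0.
have [L L0 HL] := poly_le_expR_sqrt w c40.
apply: (@le_lt_trans _ _ (((L * K) ^+ 2)%:E *
   \int[mu]_(x in R+) (expR (c * Num.sqrt x))%:E)%E); last first.
  by rewrite lte_mul_pinfty// lee_fin sqr_ge0.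
have mE : measurable_fun R+ (fun x : R => (expR (c * Num.sqrt x))%:E).
  apply/measurable_EFinP; apply: measurableT_comp => //.
  by apply: measurable_funM.
rewrite -ge0_integralZl_EFin ?sqr_ge0//.
apply: ge0_le_integral => //.
- by move=> x _; rewrite lee_fin sqr_ge0.
- exact: measurable_sqr_weight.
- exact: measurable_funeM.
- move=> x; rewrite /= in_itv/= andbT => x0; rewrite -EFinM lee_fin.
  set E := expR (c / 4 * Num.sqrt x).
  have E0 : 0 <= E by exact: expR_ge0.
  have -> : expR (c * Num.sqrt x) = (E * E) ^+ 2.
    by rewrite /E -expRD expr2 -expRD; congr expR; field.
  rewrite -exprMn ler_sqr_norm// normrM [leRHS]ger0_norm ?mulr_ge0// ?(ltW L0)//.
  by rewrite mulrACA ler_pM// ?HL ?GK.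
Qed.

Lemma weight_dominated_cst (K : R) : weight_dominated mu (fun=> K).
Proof.
apply: (@weight_dominated_expR _ `|K|) => // x x0.
by rewrite ler_peMr// -expR0 ler_expR mulr_ge0 ?sqrtr_ge0// divr_ge0// ltW.
Qed.

(** The cosine being even, cos (s sqrt x) is a power series in x itself, whose
partial sums are polynomials dominated by exp (s sqrt x). *)
Lemma poly_approximable_cos_sqrt (s : R) : 0 <= s -> s <= c / 4 ->
  poly_approximable mu (fun x => cos (s * Num.sqrt x)).
Proof.
move=> s0 sc.
pose p n : {poly R} := \poly_(i < n) ((-1) ^+ i * s ^+ i.*2 / i.*2`!%:R).
have pE n x : 0 <= x -> (p n).[x] = series (cos_coeff' (s * Num.sqrt x)) n.
  move=> x0; rewrite horner_poly /series /= big_mkord; apply: eq_bigr => i _.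
  rewrite /cos_coeff' -exprnP exprMn -[in X in _ = _ * (_ * X) / _]mul2n exprM.
  by rewrite sqr_sqrtr// mulrA [RHS]mulrAC.
have mcos : measurable_fun setT (fun x : R => cos (s * Num.sqrt x)).
  apply: (@measurableT_comp _ _ _ _ _ _ (@cos R)).
    by apply: continuous_measurable_fun; exact: continuous_cos.
  by apply: measurable_funM.
apply: (@poly_approximable_dominated _ _ (fun n => horner (p n)) _
  (fun x => 2 * expR (c / 4 * Num.sqrt x))) => //.
- by move=> n; exact: poly_approximable_horner.
- apply: (@weight_dominated_expR _ 2) => [|x x0].
    apply: measurable_funM => //; apply: measurableT_comp => //.
    by apply: measurable_funM.
  by rewrite ger0_norm// mulr_ge0// expR_ge0.
- move=> n x x0; rewrite pE//.
  have sE : expR (s * Num.sqrt x) <= expR (c / 4 * Num.sqrt x).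
    by rewrite ler_expR ler_wpM2r// sqrtr_ge0.
  rewrite (le_trans (ler_normB _ _))// mulr2n mulrDl mul1r lerD//.
    rewrite (le_trans (norm_series_cos_coeff_le _ _))//.
    by rewrite ger0_norm// mulr_ge0// sqrtr_ge0.
  rewrite (@le_trans _ _ 1)//; first by rewrite ler_norml cos_geN1 cos_le1.
  by rewrite -expR0 ler_expR mulr_ge0 ?sqrtr_ge0// divr_ge0// ltW.
- move=> x x0; under eq_fun do rewrite pE//.
  exact: cvg_cos_coeff'.
Qed.

(** When v is bounded, D (v) lies between 1 and some M, and 1 / D (v) is the sum of
the geometric series of ratio 1 - D (v) / M divided by M. Its partial sums are
polynomials in v within distance 1 of the limit. *)
Lemma poly_approximable_inv_comp (D : {poly R}) (v : R -> R) (B : R) :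
  (forall x, 1 <= D.[x]) -> (forall x, 0 <= x -> 0 <= v x <= B) ->
  poly_approximable mu v -> poly_approximable mu (fun x => (D.[v x])^-1).
Proof.
move=> D1 vB Av; have mv := Av.1.
have D0 x : 0 < D.[x] by exact: lt_le_trans (D1 x).
have [K K0 HK] := poly_le_expR_sqrt D (@ltr01 R).
pose M := K * expR (1 * Num.sqrt B).
have DM x : 0 <= x -> D.[v x] <= M.
  move=> /vB/andP[v0 vB']; rewrite (le_trans (ler_norm _))// (le_trans (HK _ v0))//.
  by rewrite ler_pM2l// ler_expR ler_wpM2l// ler_wsqrtr.
have M0 : 0 < M by rewrite mulr_gt0// expR_gt0.
pose E := horner (1 - M^-1 *: D) \o v.
have EE x : E x = 1 - D.[v x] / M by rewrite /E /= !hornerE mulrC.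
have E01 x : 0 <= x -> 0 <= E x < 1.
  move=> x0; rewrite EE subr_ge0 ler_pdivrMr// mul1r DM//= gtrBl.
  by rewrite divr_gt0.
have AE : poly_approximable mu E.
  apply: (@poly_approximable_comp _ _ _ _ B) => // x /vB/andP[v0 ?].
  by rewrite ger0_norm.
pose f n := horner (M^-1 *: \sum_(i < n) 'X^i) \o E.
have fE n x : f n x = M^-1 * \sum_(i < n) E x ^+ i.
  rewrite -[LHS]/((M^-1 *: \sum_(i < n) 'X^i).[E x]) hornerZ horner_sum.
  by congr (_ * _); apply: eq_bigr => i _; rewrite hornerXn.
have fE' n x : 0 <= x -> f n x - (D.[v x])^-1 = - (E x ^+ n / D.[v x]).
  move=> x0; rewrite fE; have /andP[E0 E1] := E01 x x0.
  have := subrX1 (E x) n; set S := \sum_(i < n) _.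
  have -> : E x - 1 = - (D.[v x] / M) by rewrite EE; ring.
  move=> HS; have Dn : D.[v x] != 0 by rewrite gt_eqF.
  have Mn : M != 0 by rewrite gt_eqF.
  have -> : E x ^+ n = 1 - D.[v x] / M * S by rewrite -mulNr -HS; ring.
  by field; rewrite Dn.
have mf : measurable_fun setT (fun x : R => (D.[v x])^-1).
  apply: (@measurableT_comp _ _ _ _ _ _ (fun x : R => (D.[x])^-1)) => //.
  apply: continuous_measurable_fun => x; apply: cvgV; first by rewrite gt_eqF.
  exact: continuous_horner.
apply: (@poly_approximable_dominated _ _ f _ (fun=> 1)) => //.
- move=> n; apply: (@poly_approximable_comp _ _ _ _ 1) => // x /E01/andP[E0 E1].
  by rewrite ger0_norm// ltW.
- exact: weight_dominated_cst.
- move=> n x x0; rewrite fE'// normrN; have /andP[E0 E1] := E01 x x0.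
  rewrite ger0_norm; last by rewrite divr_ge0 ?exprn_ge0// ltW.
  by rewrite mulr_ile1 ?exprn_ge0 ?invr_ge0 ?exprn_ile1 ?invf_le1 ?(ltW E1) ?(ltW (D0 _)).
- move=> x x0; rewrite -[X in _ --> X]addr0.
  have -> : f^~ x = (fun n => (D.[v x])^-1 - E x ^+ n / D.[v x]).
    by apply/funext => n; rewrite -fE'// addrC subrK.
  rewrite -[X in _ --> _ + X]oppr0; apply: cvgB; first exact: cvg_cst.
  rewrite -[X in _ --> X](mul0r (D.[v x])^-1); apply: cvgM; last exact: cvg_cst.
  by apply: cvg_expr; have /andP[E0 E1] := E01 x x0; rewrite ger0_norm.
Qed.

(** The identity is unbounded, but it is the limit of the bounded functions
v n = (sin (s n sqrt x) / s n)^2 with s n -> 0, and these are affine functions of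
cos (2 s n sqrt x). Convergence of 1 / D (v n) is dominated by 1 since D >= 1. *)
Lemma poly_approximable_inv (D : {poly R}) : (forall x, 1 <= D.[x]) ->
  poly_approximable mu (fun x => (D.[x])^-1).
Proof.
move=> D1; have D0 x : 0 < D.[x] by exact: lt_le_trans (D1 x).
pose d := c / 8; have d0 : 0 < d by rewrite divr_gt0.
pose s n := d / n.+1%:R; have s0 n : 0 < s n by rewrite divr_gt0.
have sd n : s n <= d by rewrite ler_pdivrMr// ler_peMr ?ler1n// ltW.
pose v n x := (sin (Num.sqrt x * s n) / s n) ^+ 2.
have vE n x : v n x = (2^-1 - 2^-1 * cos (2 * s n * Num.sqrt x)) / (s n) ^+ 2.
  rewrite /v exprMn exprVn; congr (_ / _).
  rewrite (_ : 2 * s n * _ = (Num.sqrt x * s n) *+ 2); last by ring.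
  by rewrite cos_mulr2n cos2sin2; field.
have v_cvg x : 0 <= x -> v n x @[n --> \oo] --> x.
  move=> x0; have h := @cvg_sin_dilation R d (Num.sqrt x) d0.
  by rewrite -[X in _ --> X](sqr_sqrtr x0); exact: (cvgM h h).
have Av n : poly_approximable mu (v n).
  pose p : {poly R} := (2^-1 / (s n) ^+ 2)%:P - (2^-1 / (s n) ^+ 2) *: 'X.
  rewrite (_ : v n = horner p \o (fun x => cos (2 * s n * Num.sqrt x))); last first.
    by apply/funext => x; rewrite vE /p /= !hornerE; ring.
  apply: (@poly_approximable_comp _ _ _ _ 1).
    by move=> x _; rewrite ler_norml cos_geN1 cos_le1.
  apply: poly_approximable_cos_sqrt; first by rewrite mulr_ge0// ltW.
  by have := sd n; rewrite /d; lra.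
have mf : measurable_fun setT (fun x : R => (D.[x])^-1).
  apply: continuous_measurable_fun => x; apply: cvgV; first by rewrite gt_eqF.
  exact: continuous_horner.
apply: (@poly_approximable_dominated _ _ (fun n x => (D.[v n x])^-1) _ (fun=> 1)) => //.
- move=> n; apply: (@poly_approximable_inv_comp _ _ ((s n) ^- 2)) => // x x0.
  rewrite sqr_ge0/= /v exprMn exprVn; apply: ler_piMl.
    by rewrite invr_ge0 sqr_ge0.
  by rewrite sin2cos2 gerBl sqr_ge0.
- exact: weight_dominated_cst.
- move=> n x x0; have h y : 0 <= (D.[y])^-1 <= 1.
    by rewrite invr_ge0 ltW//= invf_le1.
  have /andP[a0 a1] := h (v n x); have /andP[b0 b1] := h x.
  by rewrite ler_norml; apply/andP; split; lra.
- move=> x x0; apply: cvgV; first by rewrite gt_eqF.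
  apply: (@cvg_comp _ _ _ (fun n => v n x) (horner D)); first exact: v_cvg.
  exact: continuous_horner.
Qed.

End HardyDensity.

(** * Determinacy under Hardy's condition *)

Lemma bernoulli_le (R : realDomainType) (u : R) n : 0 <= u ->
  1 + n%:R * u <= (1 + u) ^+ n.
Proof.
move=> u0; elim: n => [|n IH]; first by rewrite mul0r addr0 expr0.
rewrite exprS; apply: (@le_trans _ _ ((1 + u) * (1 + n%:R * u))).
  rewrite -subr_ge0 -natr1 (_ : _ - _ = n%:R * u ^+ 2); last by ring.
  by rewrite mulr_ge0 ?sqr_ge0.
by rewrite ler_wpM2l// addr_ge0.
Qed.

Lemma integral_probability_cst d (T : measurableType d) (R : realType)
    (P : probability T R) (r : R) : (\int[P]_t r%:E = r%:E)%E.
Proof.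
rewrite integral_cst// -[RHS]mule1; congr (_ * _)%E; exact: probability_setT.
Qed.

Section RieszArgument.
Context (R : realType).
Implicit Types (m mu nu : probability R R) (p D : {poly R}).

Definition monomials_integrable m := forall k : nat, (0 < k)%N ->
  m.-integrable [set: R] (fun x => (x ^+ k)%:E).

Lemma monomial_integrable m k : monomials_integrable m ->
  m.-integrable [set: R] (fun x => (x ^+ k)%:E).
Proof.
case: k => [|k] Hm; last exact: Hm.
by under eq_fun do rewrite expr0; exact: finite_measure_integrable_cst.
Qed.

Let polyE p : EFin \o horner p =
  (fun x => \sum_(i < size p) ((p`_i)%:E * (x ^+ i)%:E))%E.
Proof.
by apply/funext => x; rewrite /= horner_coef -sumEFin.
Qed.

Lemma poly_integrable m p : monomials_integrable m ->
  m.-integrable [set: R] (EFin \o horner p).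
Proof.
move=> Hm; rewrite polyE; apply: integrable_sum => // i _.
by apply: integrableZl => //; exact: monomial_integrable.
Qed.

Lemma eq_integral_poly mu nu p :
  monomials_integrable mu -> monomials_integrable nu ->
  (forall k : nat, (0 < k)%N ->
    (\int[nu]_x (x ^+ k)%:E = \int[mu]_x (x ^+ k)%:E)%E) ->
  (\int[nu]_x (p.[x])%:E = \int[mu]_x (p.[x])%:E)%E.
Proof.
move=> Hmu Hnu E.
have int m : monomials_integrable m -> (\int[m]_x (p.[x])%:E =
    \sum_(i < size p) (p`_i)%:E * \int[m]_x (x ^+ i)%:E)%E.
  move=> Hm; rewrite -[X in integral m _ X]/(EFin \o horner p) polyE integral_sum//.
    apply: eq_bigr => i _; rewrite integralZl//; exact: monomial_integrable.
  by move=> i; apply: integrableZl => //; exact: monomial_integrable.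
rewrite !int//; apply: eq_bigr => i _; congr (_ * _)%E.
case: (posnP i) => [->|/E//].
have int1 m : (\int[m]_x ((x : R) ^+ 0)%:E = 1)%E.
  by under eq_integral do rewrite expr0; exact: integral_probability_cst.
by rewrite !int1.
Qed.

Lemma inv_poly_integrable m D : (forall x, 1 <= D.[x]) ->
  m.-integrable [set: R] (fun x => ((D.[x])^-1)%:E).
Proof.
move=> D1; have D0 x : 0 < D.[x] by exact: lt_le_trans (D1 x).
apply: (@le_integrable _ _ _ _ _ _ _ (cst 1%E)) => //.
- apply/measurable_EFinP; apply: continuous_measurable_fun => x.
  by apply: cvgV; [rewrite gt_eqF|exact: continuous_horner].
- move=> x _; rewrite lee_fin normr1 ger0_norm ?invr_ge0 ?(ltW (D0 _))//.
  by rewrite invf_le1.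
- exact: (finite_measure_integrable_cst m 1).
Qed.

(** With a = 1 - D p one has |1 / D - p| = |a| / D <= |a| <= e + a^2 / e. What has to
be small is the integral of a polynomial, so the estimate holds for all measures
with the same moments as soon as it holds for one. *)
Lemma inv_poly_close m D p (e : R) : monomials_integrable m ->
  (forall x, 1 <= D.[x]) -> 0 < e ->
  (\int[m]_x (((1 - D * p) ^+ 2).[x])%:E <= (e ^+ 2)%:E)%E ->
  (`| \int[m]_x ((D.[x])^-1)%:E - \int[m]_x (p.[x])%:E | <= (2 * e)%:E)%E.
Proof.
move=> Hm D1 e0 H; have D0 x : 0 < D.[x] by exact: lt_le_trans (D1 x).
have iD := inv_poly_integrable m D1; have ip := poly_integrable p Hm.
have ir := poly_integrable ((1 - D * p) ^+ 2) Hm.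
rewrite -integralB//; apply: (le_trans (le_abse_integral _ _ _)) => //.
  by have := integrableB measurableT iD ip; apply: measurable_int.
apply: (@le_trans _ _ (\int[m]_x (e%:E + e^-1%:E * (((1 - D * p) ^+ 2).[x])%:E))%E).
  apply: ge0_le_integral => //.
  - apply: measurableT_comp => //.
    by have := integrableB measurableT iD ip; apply: measurable_int.
  - apply: emeasurable_funD => //; apply: measurable_funeM.
    by move: ir; apply: measurable_int.
  - move=> x _; rewrite -EFinB -EFinM -EFinD lee_fin.
    have Ea : (1 - D * p).[x] = 1 - D.[x] * p.[x] by rewrite !hornerE.
    rewrite horner_exp Ea; set a := 1 - D.[x] * p.[x].
    have -> : (D.[x])^-1 - p.[x] = a / D.[x].
      by rewrite /a; field; rewrite gt_eqF.
    apply: (@le_trans _ _ `|a|).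
      rewrite normrM [`|_^-1|]ger0_norm ?invr_ge0 ?(ltW (D0 _))//.
      by rewrite ler_piMr// invf_le1.
    rewrite -[a ^+ 2]real_normK ?num_real//; move: `|a| (normr_ge0 a) => b b0.
    rewrite -(ler_pM2r e0) mulrDl mulrAC mulVf ?gt_eqF// mul1r -subr_ge0.
    (* After multiplication by e, the claim b <= e + b^2 / e is b e <= e^2 + b^2. *)
    have -> : e * e + b ^+ 2 - b * e = (e - b / 2) ^+ 2 + 3 / 4 * b ^+ 2 by field.
    by rewrite addr_ge0 ?sqr_ge0// mulr_ge0 ?sqr_ge0// divr_ge0.
rewrite integralD//; last 2 first.
  exact: (finite_measure_integrable_cst m e).
  exact: integrableZl.
rewrite integral_probability_cst integralZl//.
rewrite mulr2n mulrDl mul1r EFinD leeD2l//.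
apply: (@le_trans _ _ (e^-1%:E * (e ^+ 2)%:E)%E).
  by rewrite lee_pmul2l// lte_fin invr_gt0.
by rewrite -EFinM lee_fin expr2 mulKf// gt_eqF.
Qed.

(** Write N = n + 1 and t = (x - a) / N - 1. On ]-oo, a] one has |t| >= 1, so that the
polynomial is at least N. At a point x > a one has |t| < 1 for large N, and
t^(2 N^3) is of the order of exp (- 2 (x - a) N^2), small enough to beat the factor
N. The exponent is even to keep the polynomial above 1 on the whole line. *)
Definition inv_halfline (a : R) (n : nat) : {poly R} :=
  1 + n.+1%:R *: ((n.+1%:R^-1)%:P * ('X - (a + n.+1%:R)%:P)) ^+ (2 * n.+1 ^ 3).

Lemma inv_halflineE a n x : (inv_halfline a n).[x] =
  1 + n.+1%:R * ((x - a) / n.+1%:R - 1) ^+ (2 * n.+1 ^ 3).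
Proof.
rewrite /inv_halfline hornerD hornerZ horner_exp !hornerE; congr (1 + _ * _ ^+ _).
by field.
Qed.

Lemma inv_halfline_ge1 a n x : 1 <= (inv_halfline a n).[x].
Proof.
by rewrite inv_halflineE lerDl mulr_ge0// exprM exprn_ge0// sqr_ge0.
Qed.

Lemma inv_halfline_cvg a x :
  ((inv_halfline a n).[x])^-1 @[n --> \oo] --> (\1_(`]a, +oo[) x : R).
Proof.
have [xa|ax] := leP x a.
  rewrite indicE memNset; last by rewrite /= in_itv/= andbT ltNge xa.
  apply: (squeeze_cvgr (f := fun=> 0) (h := fun n => n.+1%:R^-1)); [|exact: cvg_cst|exact: cvg_harmonic].
  apply: nearW => n; have D1 := inv_halfline_ge1 a n x.
  rewrite invr_ge0 (le_trans _ D1)//= lef_pV2 ?posrE//; last exact: lt_le_trans D1.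
  rewrite inv_halflineE ler_wpDl// ler_peMr//.
  set J := _ - 1; rewrite exprM exprn_ege1// -[J ^+ 2]real_normK ?num_real//.
  rewrite exprn_ege1// ler_normr; apply/orP; right.
  by rewrite /J opprB lerDl oppr_ge0 pmulr_lle0 ?invr_gt0// subr_le0.
rewrite indicE mem_set; last by rewrite /= in_itv/= andbT.
pose d := x - a; have d0 : 0 < d by rewrite subr_gt0.
rewrite -[X in _ --> X]invr1; apply: cvgV; first exact: oner_neq0.
rewrite -[X in _ --> X]addr0; under eq_fun do rewrite inv_halflineE.
apply: cvgD; first exact: cvg_cst.
apply: (squeeze_cvgr (f := fun=> 0) (h := fun n => (2 * d)^-1 * n.+1%:R^-1)); [|exact: cvg_cst|]; last first.
  by rewrite -[X in _ --> X](mulr0 (2 * d)^-1); apply: cvgM; [exact: cvg_cst|exact: cvg_harmonic].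
near=> n; set N : R := n.+1%:R.
have N0 : 0 < N by [].
have dN : d <= N.
  apply: (@le_trans _ _ n%:R); last by rewrite ler_nat.
  by near: n; exact: nbhs_infty_ger.
have u0 : 0 < d / N by rewrite divr_gt0.
have u1 : d / N <= 1 by rewrite ler_pdivrMr// mul1r.
rewrite exprM; set J := _ - 1.
have J2 : J ^+ 2 = (1 - d / N) ^+ 2 by rewrite /J -/d; ring.
apply/andP; split; first by rewrite mulr_ge0 ?(ltW N0)// exprn_ge0// sqr_ge0.
rewrite J2 -exprM; set K := (2 * _)%N.
(* As (1 - y) (1 + y) <= 1, an upper bound on (1 - y)^K follows from Bernoulli's
   lower bound on (1 + y)^K. *)
have K1 : 1 + K%:R * (d / N) <= (1 + d / N) ^+ K.
  by apply: bernoulli_le; exact: ltW.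
have rK : (1 - d / N) ^+ K * (1 + d / N) ^+ K <= 1.
  rewrite -exprMn exprn_ile1//; last by rewrite -subr_sqr expr1n gerBl sqr_ge0.
  by rewrite mulr_ge0 ?subr_ge0// addr_ge0// ltW.
have KE : K%:R * (d / N) = 2 * d * N ^+ 2.
  by rewrite /K natrM natrX -/N; field.
rewrite -invfM -[leRHS]mul1r ler_pdivlMr ?mulr_gt0//.
have r0 : 0 <= (1 - d / N) ^+ K by rewrite exprn_ge0// subr_ge0.
have : (1 - d / N) ^+ K * (2 * d * N ^+ 2) <= 1.
  apply: le_trans rK; apply: ler_wpM2l => //; apply: le_trans K1.
  by rewrite KE lerDr.
by rewrite [X in X <= 1 -> _](_ : _ = N * (1 - d / N) ^+ K * (2 * d * N)); [|ring].
Unshelve. all: by end_near. Qed.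

(** Open half-lines bounded below form a pi-system that generates the Borel sets. *)
Lemma probability_eq_halflines mu nu :
  (forall a : R, nu `]a, +oo[%classic = mu `]a, +oo[%classic) ->
  forall A : set R, measurable A -> nu A = mu A.
Proof.
move=> E A mA.
apply: (@measure_unique _ R _ (@RGenOInfty.G R)
  (fun n => `](- n%:R)%R, +oo[%classic) _ _ _ _ nu mu) => //.
- exact: (@RGenOInfty.measurableE R).
- move=> _ _ [x ->] [y ->]; exists (Num.max x y).
  apply/seteqP; split => z /=; rewrite !in_itv/= !andbT gt_max.
    by move=> [-> ->].
  by move=> /andP[-> ->].
- by move=> i; exists (- i%:R).
- rewrite -subTset => x _ /=; exists (Num.bound `|x|) => //=.
  rewrite in_itv/= andbT ltrNl (le_lt_trans (ler_norm _))// normrN.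
  exact: archi_boundP.
- by move=> _ [x ->]; exact: E.
- by move=> k; rewrite (le_lt_trans (probability_le1 _ _))// ltry.
Qed.

Lemma eq_of_integral_inv_poly mu nu :
  (forall D, (forall x, 1 <= D.[x]) ->
    (\int[nu]_x ((D.[x])^-1)%:E = \int[mu]_x ((D.[x])^-1)%:E)%E) ->
  forall A : set R, measurable A -> nu A = mu A.
Proof.
move=> E; apply: probability_eq_halflines => a.
have cv m : (\int[m]_x (((inv_halfline a n).[x])^-1)%:E @[n --> \oo]
    --> m `]a, +oo[%classic)%E.
  have <- : (\int[m]_x (\1_(`]a, +oo[) x)%:E = m `]a, +oo[%classic)%E.
    by rewrite integral_indic// setIT.
  apply: (dominated_cvg measurableT (g := cst 1%E)) => //.
  - by move=> n; apply: measurable_int; apply: inv_poly_integrable => // x; exact: inv_halfline_ge1.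
  - by move=> x _; apply: cvg_EFin; [exact: nearW|exact: inv_halfline_cvg].
  - exact: (finite_measure_integrable_cst m 1).
  - move=> n x _; have h := inv_halfline_ge1 a n x.
    have h0 : 0 < (inv_halfline a n).[x] by exact: lt_le_trans h.
    by rewrite lee_fin ger0_norm ?invf_le1// invr_ge0 ltW.
apply: (cvg_unique _ (cv nu)) => //.
rewrite /= [X in X @ _](_ : _ = fun n =>
    \int[mu]_x (((inv_halfline a n).[x])^-1)%:E)%E; first exact: cv.
by apply/funext => n; apply: E => x; exact: inv_halfline_ge1.
Qed.

Lemma ge0_integral_carrier mu (f : R -> \bar R) : mu `]-oo, 0[%classic = 0%E ->
  measurable_fun setT f -> (forall x, 0 <= f x)%E ->
  (\int[mu]_x f x = \int[mu]_(x in `[0%R, +oo[) f x)%E.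
Proof.
move=> mu0 mf f0.
rewrite (@ge0_negligible_integral _ _ _ mu setT `]-oo, 0[%classic)//.
congr integral; apply/seteqP; split => x /=; rewrite !in_itv/= andbT.
  by move=> [_ /negP]; rewrite -leNgt.
by move=> x0; split => //; apply/negP; rewrite -leNgt.
Qed.

Lemma exp_sqrt_monomials_integrable mu (c : R) : 0 < c ->
  mu `]-oo, 0[%classic = 0%E ->
  (\int[mu]_(x in `[0%R, +oo[) (expR (c * Num.sqrt x))%:E < +oo)%E ->
  monomials_integrable mu.
Proof.
move=> c0 mu0 H k _.
have mE (D : set R) : measurable_fun D (fun x : R => (expR (c * Num.sqrt x))%:E).
  apply/measurable_EFinP; apply: measurableT_comp => //.
  apply: measurable_funM => //; apply: measurable_funTS.
  by apply: continuous_measurable_fun; exact: sqrt_continuous.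
have mX (D : set R) : measurable_fun D (fun x : R => (x ^+ k)%:E).
  by apply/measurable_EFinP; apply: measurable_funX.
apply/integrableP; split => //.
rewrite ge0_integral_carrier//; last by apply: measurableT_comp.
have [K K0 HK] := poly_le_expR_sqrt ('X^k : {poly R}) c0.
apply: (@le_lt_trans _ _ (K%:E *
    \int[mu]_(x in `[0%R, +oo[) (expR (c * Num.sqrt x))%:E)%E); last first.
  by rewrite lte_mul_pinfty// lee_fin ltW.
rewrite -ge0_integralZl_EFin//; last exact: ltW.
apply: ge0_le_integral => //.
- by apply: measurableT_comp.
- exact: measurable_funeM.
- move=> x; rewrite /= in_itv/= andbT => x0; rewrite -EFinM lee_fin.
  by have := HK x x0; rewrite hornerXn.
Qed.

(** Nothing is assumed on where nu lives: mu enters through an estimate on the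
half-line, and passes it on to nu through integrals of polynomials only. *)
Theorem hardy_determinacy mu nu (c : R) : 0 < c ->
  mu `]-oo, 0[%classic = 0%E ->
  (\int[mu]_(x in `[0%R, +oo[) (expR (c * Num.sqrt x))%:E < +oo)%E ->
  monomials_integrable nu ->
  (forall k : nat, (0 < k)%N ->
    (\int[nu]_x (x ^+ k)%:E = \int[mu]_x (x ^+ k)%:E)%E) ->
  forall A : set R, measurable A -> nu A = mu A.
Proof.
move=> c0 mu0 H Hnu E; apply: eq_of_integral_inv_poly => D D1.
have D0 x : 0 < D.[x] by exact: lt_le_trans (D1 x).
have Hmu := exp_sqrt_monomials_integrable c0 mu0 H.
have fin m : (\int[m]_x ((D.[x])^-1)%:E)%E \is a fin_num.
  by apply: integrable_fin_num => //; exact: inv_poly_integrable.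
have close (e : R) : 0 < e ->
  `|fine (\int[nu]_x ((D.[x])^-1)%:E) - fine (\int[mu]_x ((D.[x])^-1)%:E)| <= e.
  move=> e0; have e4 : 0 < e / 4 by rewrite divr_gt0.
  (* With D itself as the weight, (D (1 / D - p))^2 is the polynomial (1 - D p)^2. *)
  have [p Hp] := (poly_approximable_inv c0 H D1).2 D ((e / 4) ^+ 2)
    ltac:(by rewrite exprn_gt0).
  have Emu : (\int[mu]_x (((1 - D * p) ^+ 2).[x])%:E <= ((e / 4) ^+ 2)%:E)%E.
    rewrite ge0_integral_carrier//; last 2 first.
      by apply/measurable_EFinP; exact: measurable_poly.
      by move=> x; rewrite horner_exp lee_fin sqr_ge0.
    apply: le_trans (ltW Hp); rewrite le_eqVlt; apply/orP; left; apply/eqP.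
    apply: eq_integral => x _; congr EFin; rewrite horner_exp; congr (_ ^+ 2).
    by rewrite mulrBr divff ?gt_eqF// !hornerE.
  have Enu : (\int[nu]_x (((1 - D * p) ^+ 2).[x])%:E <= ((e / 4) ^+ 2)%:E)%E.
    by rewrite (eq_integral_poly _ Hmu Hnu).
  have Cmu := inv_poly_close Hmu D1 e4 Emu.
  have Cnu := inv_poly_close Hnu D1 e4 Enu.
  rewrite (eq_integral_poly p Hmu Hnu E) in Cnu.
  have finp : (\int[mu]_x (p.[x])%:E)%E \is a fin_num.
    by apply: integrable_fin_num => //; exact: poly_integrable.
  move: Cmu Cnu; rewrite -(fineK (fin mu)) -(fineK (fin nu)) -(fineK finp).
  rewrite -!EFinB !lee_fin /=.
  by rewrite !ler_norml => /andP[? ?] /andP[? ?]; apply/andP; split; lra.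
rewrite -(fineK (fin mu)) -(fineK (fin nu)); congr EFin; apply/eqP.
rewrite -subr_eq0 -normr_le0; apply/ler_addgt0Pr => e e0; rewrite add0r.
exact: close.
Qed.

End RieszArgument.

(** * Products of two light-tailed variables *)

Section DensityIntegral.
Context d (T : measurableType d) (R : realType).
Variables (lam m : {measure set T -> \bar R}) (p : T -> R).
Hypothesis mp : measurable_fun setT p.
Hypothesis p_ge0 : forall x, 0 <= p x.
Hypothesis m_density :
  forall A : set T, measurable A -> m A = (\int[lam]_(x in A) (p x)%:E)%E.

Import HBNNSimple.

Let ge0_integral_density_nnsfun (h : {nnsfun T >-> R}) :
  (\int[m]_x (h x)%:E = \int[lam]_x ((h x)%:E * (p x)%:E))%E.
Proof.
have hE x : (h x)%:E =
    (\sum_(y \in range h) (y * \1_(h @^-1` [set y]) x)%:E)%E.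
  by rewrite fsumEFin// -fimfunE.
under eq_integral do rewrite hE.
rewrite ge0_integral_fsum//; last 2 first.
  by move=> y; apply/measurable_EFinP; exact: measurable_funM.
  by move=> y x _; exact: nnfun_muleindic_ge0.
under [RHS]eq_integral => x _.
  rewrite hE ge0_mule_fsuml; last by move=> y; exact: nnfun_muleindic_ge0.
  over.
rewrite ge0_integral_fsum//; last 2 first.
  move=> y; apply: emeasurable_funM; last exact/measurable_EFinP.
  by apply/measurable_EFinP; exact: measurable_funM.
  by move=> y x _; apply: mule_ge0; [exact: nnfun_muleindic_ge0|rewrite lee_fin].
apply: eq_fsbigr => y yh.
have y0 : 0 <= y by move: yh; rewrite inE => -[x _ <-].
have mA : measurable (h @^-1` [set y]) by exact: measurable_sfunP.
under eq_integral do rewrite EFinM.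
under [RHS]eq_integral do rewrite EFinM -muleA.
rewrite !ge0_integralZl_EFin//; last 3 first.
  by move=> x _; rewrite mule_ge0 ?lee_fin ?p_ge0.
  by apply: emeasurable_funM; exact/measurable_EFinP.
  exact/measurable_EFinP.
rewrite integral_indic// setIT m_density//; congr (_ * _)%E.
rewrite integral_mkcond; apply: eq_integral => x _.
by rewrite muleC epatch_indic.
Qed.

Lemma ge0_integral_density (f : T -> \bar R) :
  measurable_fun setT f -> (forall x, 0 <= f x)%E ->
  (\int[m]_x f x = \int[lam]_x (f x * (p x)%:E))%E.
Proof.
move=> mf f0; pose h := nnsfun_approx measurableT mf.
have hf x : (h n x)%:E @[n --> \oo] --> f x by exact: cvg_nnsfun_approx.
have ndh x : {homo (fun n => (h n x)%:E) : a b / (a <= b)%N >-> (a <= b)%E}.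
  by move=> a b ab; rewrite lee_fin; exact/lefP/nd_nnsfun_approx.
transitivity (limn (fun n => \int[m]_x (h n x)%:E))%E.
  rewrite -monotone_convergence//.
  - by apply: eq_integral => x _; apply/esym/cvg_lim.
  - by move=> n; exact/measurable_EFinP.
  - by move=> n x _; rewrite lee_fin.
transitivity (limn (fun n => \int[lam]_x ((h n x)%:E * (p x)%:E)))%E.
  by congr (limn _); apply/funext => n; exact: ge0_integral_density_nnsfun.
rewrite -monotone_convergence//.
- apply: eq_integral => x _; apply/cvg_lim => //.
  by apply: cvgeZr; [|exact: hf].
- by move=> n; apply: emeasurable_funM; exact/measurable_EFinP.
- by move=> n x _; rewrite mule_ge0 ?lee_fin.
- by move=> x _ a b ab; rewrite lee_wpmul2r ?lee_fin ?p_ge0//; have := ndh x a b ab; rewrite lee_fin.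
Qed.

End DensityIntegral.

Lemma ge0_integral_lebesgue_density (R : realType)
    (m : {measure set R -> \bar R}) (p : R -> R) (f : R -> \bar R) :
  measurable_fun setT p -> (forall x, 0 <= p x) ->
  (forall A : set R, measurable A ->
     m A = (\int[lebesgue_measure]_(x in A) (p x)%:E)%E) ->
  measurable_fun setT f -> (forall x, 0 <= f x)%E ->
  (\int[m]_x f x = \int[lebesgue_measure]_x (f x * (p x)%:E))%E.
Proof.
move=> mp p0 mE mf f0.
(* Lebesgue measure is a measure on measurableTypeR R, a copy of R under another
   display; m is moved there by the identity map. *)
pose i : R -> measurableTypeR R := idfun.
have mi : measurable_fun setT i by exact: (@measurable_id _ R setT).
pose m_ : {measure set (measurableTypeR R) -> \bar R} := pushforward m i.
transitivity (\int[m_ mi]_x f x)%E.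
  rewrite [RHS](@ge0_integral_pushforward _ _ _ (measurableTypeR R) _ i mi m setT f)//.
exact: (@ge0_integral_density _ (measurableTypeR R) R lebesgue_measure (m_ mi)
  p mp p0 mE f mf f0).
Qed.

(** The geometric mean is at most the larger factor. This is why two factors with
exponential tails, independent or not, satisfy Hardy's condition, while three do
not in general. *)
Lemma expR_sqrtM_le (R : realType) (c x y : R) : 0 <= c ->
  expR (c * Num.sqrt (x * y)) <= expR (c * `|x|) + expR (c * `|y|).
Proof.
move=> c0; wlog xy : x y / `|x| <= `|y|.
  move=> H; have [xy|/ltW yx] := leP `|x| `|y|; first exact: H.
  by rewrite [x * y]mulrC [leRHS]addrC; exact: H.
rewrite ler_wpDl ?expR_ge0// ler_expR ler_wpM2l// -[leRHS]sqrtr_sqr ler_wsqrtr//.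
rewrite (le_trans (ler_norm _))// normrM expr2.
by rewrite -[leRHS]ger0_norm ?sqr_ge0// -expr2 normrX expr2 ler_wpM2r.
Qed.

Section ProductDeterminacy.
Context d (T : measurableType d) (R : realType) (P : probability T R).

Definition light_tailed (X : T -> R) : Prop :=
  exists2 c : R, 0 < c & (\int[P]_w (expR (c * `|X w|))%:E < +oo)%E.

(** Half of the rate of the tail is spent on the exponential moment. *)
Lemma light_tailed_density (X : {RV P >-> R}) (p : R -> R) (K a : R) :
  measurable_fun setT p -> (forall x, 0 <= p x) ->
  (forall x, p x <= K * exponential_pdf a x) -> 0 < a ->
  has_law P X (fun A => \int[lebesgue_measure]_(x in A) (p x)%:E)%E ->
  light_tailed X.
Proof.
move=> mp p0 pK a0 law.
have a20 : 0 < a / 2 by rewrite divr_gt0.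
exists (a / 2) => //.
have mE : measurable_fun setT (fun x : R => (expR (a / 2 * `|x|))%:E).
  apply/measurable_EFinP; apply: measurableT_comp => //.
  by apply: measurable_funM => //; exact: measurableT_comp.
have e0 (x : R) : (0 <= (expR (a / 2 * `|x|))%:E)%E by rewrite lee_fin expR_ge0.
rewrite -[ltLHS](ge0_integral_distribution X mE e0).
rewrite (@ge0_integral_lebesgue_density _ (distribution P X) p _ mp p0 law mE e0).
have mpdf : measurable_fun setT (fun x : R => (exponential_pdf (a / 2) x)%:E).
  by apply/measurable_EFinP; exact: measurable_exponential_pdf.
have pdf0 x : 0 <= exponential_pdf (a / 2) x by rewrite exponential_pdf_ge0// ltW.
apply: (@le_lt_trans _ _
    (\int[lebesgue_measure]_x ((`|K| * 2)%:E * (exponential_pdf (a / 2) x)%:E))%E); last first.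
  rewrite ge0_integralZl_EFin//; last by move=> x _; rewrite lee_fin pdf0.
  by rewrite integral_exponential_pdf// mule1 ltry.
apply: ge0_le_integral => //.
- by move=> x _; rewrite mule_ge0 ?lee_fin ?expR_ge0.
- by apply: emeasurable_funM => //; exact/measurable_EFinP.
- exact: measurable_funeM.
- move=> x _; rewrite -!EFinM lee_fin.
  apply: (@le_trans _ _ (expR (a / 2 * `|x|) * (`|K| * exponential_pdf a x))).
    rewrite ler_wpM2l ?expR_ge0// (le_trans (pK x))// ler_wpM2r ?ler_norm//.
    by rewrite exponential_pdf_ge0// ltW.
  have [x0|x0] := leP 0 x; last by rewrite !lt0_exponential_pdf// !mulr0.
  rewrite !exponential_pdfE// (ger0_norm x0) le_eqVlt; apply/orP; left; apply/eqP.
  transitivity (`|K| * a * (expR (a / 2 * x) * expR (- a * x))); first by ring.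
  rewrite -expRD (_ : a / 2 * x + - a * x = - (a / 2) * x); first by field.
  by field.
Qed.

Lemma light_tailed2 (X Y : {RV P >-> R}) : light_tailed X -> light_tailed Y ->
  exists2 c : R, 0 < c &
    (\int[P]_w (expR (c * `|X w|))%:E < +oo)%E /\
    (\int[P]_w (expR (c * `|Y w|))%:E < +oo)%E.
Proof.
move=> [a a0 Xa] [b b0 Yb]; exists (Num.min a b); first by rewrite lt_min a0.
have mexp c (V : {RV P >-> R}) : measurable_fun setT (fun w => (expR (c * `|V w|))%:E).
  apply/measurable_EFinP; apply: measurableT_comp => //.
  by apply: measurable_funM => //; exact: measurableT_comp.
have le_exp c c' (V : {RV P >-> R}) : c <= c' ->
    (\int[P]_w (expR (c * `|V w|))%:E <= \int[P]_w (expR (c' * `|V w|))%:E)%E.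
  move=> cc'; apply: ge0_le_integral => //; try exact: mexp.
  by move=> w _; rewrite lee_fin ler_expR ler_wpM2r.
split; [apply: le_lt_trans Xa|apply: le_lt_trans Yb]; apply: le_exp.
  by rewrite ge_min lexx.
by rewrite ge_min lexx orbT.
Qed.

Lemma product_moment_determinate (X Y : {RV P >-> R}) :
  P (X @^-1` `]-oo, 0[) = 0%E -> P (Y @^-1` `]-oo, 0[) = 0%E ->
  light_tailed X -> light_tailed Y ->
  moment_determinate P (X \* Y).
Proof.
move=> X0 Y0 lX lY; have [c c0 [EX EY]] := light_tailed2 lX lY.
pose Z : {mfun T >-> R} := (X : {mfun T >-> R}) \* (Y : {mfun T >-> R}).
pose mu := distribution P Z.
have mu0 : mu `]-oo, 0[%classic = 0%E.
  apply/eqP; rewrite eq_le measure_ge0 andbT.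
  rewrite (@le_trans _ _ (P (X @^-1` `]-oo, 0[ `|` Y @^-1` `]-oo, 0[)))//.
    rewrite -[leLHS]/(P (Z @^-1` `]-oo, 0[)); apply: le_measure; rewrite ?inE.
    - exact: measurable_funPTI.
    - by apply: measurableU; exact: measurable_funPTI.
    - move=> w /=; rewrite !in_itv/= => XY0.
      have [x0|x0] := ltP (X w) 0; [by left|right].
      by rewrite ltNge; apply/negP => y0; move: XY0; rewrite ltNge mulr_ge0.
  apply: (le_trans (measureU2 _ _ _)); try exact: measurable_funPTI.
  have X0' : (P (X @^-1` `]-oo, 0%R[) <= 0)%E by rewrite X0.
  have Y0' : (P (Y @^-1` `]-oo, 0%R[) <= 0)%E by rewrite Y0.
  by rewrite -[leRHS]adde0; exact: leeD.
have mexp (f : T -> R) : measurable_fun setT f ->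
    measurable_fun setT (fun w => (expR (c * `|f w|))%:E).
  move=> mf; apply/measurable_EFinP; apply: measurableT_comp => //.
  by apply: measurable_funM => //; exact: measurableT_comp.
have mg : measurable_fun setT (fun x : R => (expR (c * Num.sqrt x))%:E).
  apply/measurable_EFinP; apply: measurableT_comp => //.
  apply: measurable_funM => //; apply: continuous_measurable_fun.
  exact: sqrt_continuous.
have e0 (x : R) : (0 <= (expR x)%:E)%E by rewrite lee_fin expR_ge0.
have mX := mexp _ (measurable_funPT X); have mY := mexp _ (measurable_funPT Y).
have HE : (\int[mu]_(x in `[0%R, +oo[) (expR (c * Num.sqrt x))%:E < +oo)%E.
  apply: (@le_lt_trans _ _ (\int[mu]_x (expR (c * Num.sqrt x))%:E)%E).
    by apply: ge0_subset_integral => // x _; rewrite lee_fin expR_ge0.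
  rewrite (ge0_integral_distribution Z mg (fun x => e0 _)).
  apply: (@le_lt_trans _ _ (\int[P]_w ((expR (c * `|X w|))%:E + (expR (c * `|Y w|))%:E))%E); last first.
    rewrite (ge0_integralD _ measurableT (fun w _ => e0 _) mX (fun w _ => e0 _) mY).
    by apply: lte_add_pinfty; [exact: EX|exact: EY].
  apply: ge0_le_integral => //.
  - by move=> w _; exact: e0.
  - exact: (measurableT_comp mg).
  - exact: emeasurable_funD.
  - move=> w _; rewrite -EFinD lee_fin.
    by rewrite expR_sqrtM_le// ltW.
have Hmu := exp_sqrt_monomials_integrable c0 mu0 HE.
have mXk k : measurable_fun setT (fun x : R => (x ^+ k)%:E).
  by apply/measurable_EFinP; exact: measurable_funX.
have mZk k : measurable_fun setT (fun w => (Z w ^+ k)%:E).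
  by apply/measurable_EFinP; exact: measurable_funX.
have finZ : finite_moments P (X \* Y).
  move=> k k0; apply/integrableP; split; first exact: mZk.
  have /integrableP[_] := Hmu k k0.
  by rewrite ge0_integral_distribution//; exact: measurableT_comp.
split => // nu finnu momnu A mA.
rewrite (hardy_determinacy c0 mu0 HE finnu)// => k k0.
have := momnu k k0; rewrite /moment unlock => ->.
by rewrite (integral_distribution (mXk k))//; exact: finZ.
Qed.

End ProductDeterminacy.

(** * Inverse Gaussian and exponential laws *)

Section InverseGaussian.
Context (R : realType) (m l : R).
Hypothesis (m_gt0 : 0 < m) (l_gt0 : 0 < l).
Local Notation pdf := (inverse_gaussian_pdf m l).

Lemma inverse_gaussian_pdfE (x : R) : 0 < x ->
  pdf x = Num.sqrt (l / (2 * pi * x ^+ 3)) *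
    expR (- (l / (2 * m ^+ 2) * x) + l / m - l / (2 * x)).
Proof.
move=> x0; rewrite /inverse_gaussian_pdf patchE mem_set/=; last first.
  by rewrite in_itv/= andbT.
by congr (_ * expR _); field; rewrite !gt_eqF//.
Qed.

Lemma inverse_gaussian_pdf_le0 (x : R) : x <= 0 -> pdf x = 0.
Proof.
move=> x0; rewrite /inverse_gaussian_pdf patchE memNset//= in_itv/= andbT.
by apply/negP; rewrite -leNgt.
Qed.

Lemma inverse_gaussian_pdf_ge0 (x : R) : 0 <= pdf x.
Proof.
have [x0|x0] := leP x 0; first by rewrite inverse_gaussian_pdf_le0.
by rewrite inverse_gaussian_pdfE// mulr_ge0 ?sqrtr_ge0 ?expR_ge0.
Qed.

Lemma measurable_inverse_gaussian_pdf : measurable_fun setT pdf.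
Proof.
apply/measurable_restrict => //; rewrite setTI.
apply: open_continuous_measurable_fun => //= x.
rewrite inE/= in_itv/= andbT => x0.
apply: cvgM.
  apply: (@cvg_comp _ _ _ (fun y => l / (2 * pi * y ^+ 3)) (@Num.sqrt R)); last first.
    exact: sqrt_continuous.
  apply: cvgM; first exact: cvg_cst.
  apply: cvgV; first by rewrite gt_eqF// !mulr_gt0 ?exprn_gt0 ?pi_gt0.
  by apply: cvgM; [exact: cvg_cst|exact: exprn_continuous].
apply: (@cvg_comp _ _ _ (fun y => - (l * (y - m) ^+ 2 / (2 * m ^+ 2 * y))) (@expR R)); last first.
  exact: continuous_expR.
apply: cvgN; apply: cvgM.
  apply: cvgM; first exact: cvg_cst.
  have h : y - m @[y --> x] --> x - m by apply: cvgB => //; exact: cvg_cst.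
  exact: (cvgM h h).
apply: cvgV; first by rewrite gt_eqF// !mulr_gt0 ?exprn_gt0.
by apply: cvgM => //; exact: cvg_cst.
Qed.

(** Near 0 the factor x^(-3/2) is absorbed by exp (- l / (2 x)), which is half of what
the expansion of the square provides; the other half is exp (- l x / (2 m^2)). *)
Lemma inverse_gaussian_pdf_le_exponential :
  exists K, forall x, pdf x <= K * exponential_pdf (l / (2 * m ^+ 2)) x.
Proof.
pose a := l / (2 * m ^+ 2); have a0 : 0 < a by rewrite divr_gt0// mulr_gt0// exprn_gt0.
(* From y^3 / 6 <= exp y at y = l u / 2, where u = 1 / x: u^3 <= (48 / l^3) exp (l u / 2). *)
pose C := 1 + l / (2 * pi) * (48 / l ^+ 3).
have pi0 : 0 < pi :> R := pi_gt0 R.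
have C0 : 0 < C by rewrite addr_gt0// mulr_gt0// ?divr_gt0// ?exprn_gt0// mulr_gt0.
exists (C * expR (l / m) / a) => x.
have [x0|x0] := leP x 0.
  have K0 : 0 < C * expR (l / m) / a by rewrite divr_gt0// mulr_gt0// expR_gt0.
  by rewrite inverse_gaussian_pdf_le0// mulr_ge0 ?exponential_pdf_ge0// ltW.
rewrite inverse_gaussian_pdfE// (exponential_pdfE _ (ltW x0)).
set A := l / (2 * pi * x ^+ 3).
have A0 : 0 <= A by apply/ltW; rewrite divr_gt0// !mulr_gt0// exprn_gt0.
have sA : Num.sqrt A <= 1 + A.
  rewrite -[leRHS]ger0_norm ?addr_ge0// -sqrtr_sqr ler_wsqrtr//.
  by rewrite -subr_ge0 (_ : _ - _ = 1 + A + A ^+ 2) ?addr_ge0 ?sqr_ge0//; ring.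
pose u := x^-1; have u0 : 0 < u by rewrite invr_gt0.
have Au : A = l / (2 * pi) * u ^+ 3.
  rewrite /A /u.
  by move: (@pi R) pi0 => q q0; field; rewrite !gt_eqF.
have bound : (1 + A) * expR (- (l / 2 * u)) <= C.
  rewrite mulrDl mul1r /C lerD//.
    by rewrite -expR0 ler_expR oppr_le0 !mulr_ge0// ltW.
  rewrite Au -mulrA; apply: ler_wpM2l.
    by apply/ltW; rewrite divr_gt0// mulr_gt0.
  rewrite expRN ler_pdivrMr ?expR_gt0//.
  have lu0 : 0 <= l / 2 * u by rewrite !mulr_ge0// ltW.
  have := @expR_ge1Dxn R _ 2 lu0; rewrite (_ : 3`! = 6%N)// => h.
  have : (l / 2 * u) ^+ 3 <= 6 * expR (l / 2 * u) by lra.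
  have -> : (l / 2 * u) ^+ 3 = l ^+ 3 / 8 * u ^+ 3 by field.
  move=> h'; rewrite mulrAC ler_pdivlMr ?exprn_gt0//.
  by move: h'; set E := expR _; set L := l ^+ 3; set U := u ^+ 3; lra.
have -> : expR (- (l / (2 * m ^+ 2) * x) + l / m - l / (2 * x)) =
    expR (- (l / 2 * u)) * (expR (l / m) * expR (- a * x)).
  rewrite -!expRD; congr expR; rewrite /a /u; field.
  by rewrite !gt_eqF//.
rewrite [leLHS]mulrA.
apply: (@le_trans _ _ (C * (expR (l / m) * expR (- a * x)))).
  rewrite ler_wpM2r ?mulr_ge0 ?expR_ge0//; apply: le_trans bound.
  by rewrite ler_wpM2r ?expR_ge0.
rewrite le_eqVlt; apply/orP; left; apply/eqP.
by rewrite -/a; field; rewrite gt_eqF.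
Qed.

(** Away from 0 the factor x^(-3/2) costs at most a rate 1/2, by x^3 <= 6 exp x. *)
Lemma inverse_gaussian_pdf_ge_exp :
  exists k C : R, [/\ 0 < k, 0 < C & forall x, 1 <= x -> k * expR (- (C * x)) <= pdf x].
Proof.
pose a := l / (2 * m ^+ 2); have a0 : 0 < a by rewrite divr_gt0// mulr_gt0// exprn_gt0.
have pi0 : 0 < pi :> R := pi_gt0 R.
exists (Num.sqrt (l / (12 * pi)) * expR (- (l / 2))), (2^-1 + a).
split.
- by rewrite mulr_gt0 ?expR_gt0// sqrtr_gt0 divr_gt0// mulr_gt0.
- by rewrite addr_gt0.
move=> x x1; have x0 : 0 < x by exact: lt_le_trans x1.
rewrite inverse_gaussian_pdfE//.
have -> : Num.sqrt (l / (12 * pi)) * expR (- (l / 2)) * expR (- ((2^-1 + a) * x)) =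
   (Num.sqrt (l / (12 * pi)) * expR (- (x / 2))) * expR (- (l / 2) - a * x).
  by rewrite -[LHS]mulrA -[RHS]mulrA -!expRD; congr (_ * expR _); field.
apply: ler_pM; rewrite ?mulr_ge0 ?sqrtr_ge0 ?expR_ge0//.
  have -> : expR (- (x / 2)) = Num.sqrt (expR (- x)).
    rewrite -[LHS]ger0_norm ?expR_ge0// -sqrtr_sqr; congr Num.sqrt.
    by rewrite expr2 -expRD; congr expR; field.
  rewrite -sqrtrM; last by apply/ltW; rewrite divr_gt0// mulr_gt0.
  rewrite ler_wsqrtr//.
  rewrite expRN ler_pdivrMr ?expR_gt0//.
  have := @expR_ge1Dxn R x 2 (ltW x0); rewrite (_ : 3`! = 6%N)// => h.
  have h6 : x ^+ 3 <= 6 * expR x by lra.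
  have x30 : 0 < x ^+ 3 by rewrite exprn_gt0.
  have -> : l / (12 * pi) = l / (2 * pi * x ^+ 3) * (x ^+ 3 / 6).
    by move: (@pi R) pi0 => q q0; field; rewrite !gt_eqF.
  apply: ler_wpM2l; last by lra.
  by apply/ltW; rewrite divr_gt0// !mulr_gt0.
rewrite ler_expR -/a.
have lx : l / (2 * x) <= l / 2.
  rewrite ler_pM2l// lef_pV2 ?posrE ?mulr_gt0//; lra.
have : 0 < l / m by rewrite divr_gt0.
by move: lx; move: (l / (2 * x)) (l / m) (l / 2) (a * x) => p q r t *; lra.
Qed.

End InverseGaussian.

Section InverseGaussianLaw.
Context d (T : measurableType d) (R : realType) (P : probability T R).
Variables (m l : R) (X : {RV P >-> R}).
Hypotheses (m_gt0 : 0 < m) (l_gt0 : 0 < l)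
  (law : has_law P X (inverse_gaussian_prob m l)).

Lemma inverse_gaussian_le0 : P (X @^-1` `]-oo, 0]) = 0%E.
Proof.
rewrite -[LHS]/(distribution P X `]-oo, 0]%classic) law// /inverse_gaussian_prob.
rewrite integral0_eq// => x; rewrite /= in_itv/= => x0.
by rewrite inverse_gaussian_pdf_le0.
Qed.

Lemma inverse_gaussian_light_tailed : light_tailed P X.
Proof.
have [K HK] := inverse_gaussian_pdf_le_exponential m_gt0 l_gt0.
apply: (@light_tailed_density _ _ _ _ X _ K (l / (2 * m ^+ 2)) _ _ HK _ law).
- exact: measurable_inverse_gaussian_pdf.
- by move=> x; exact: inverse_gaussian_pdf_ge0.
- by rewrite divr_gt0// mulr_gt0// exprn_gt0.
Qed.

Lemma inverse_gaussian_unit_itv : exists k C : R, [/\ 0 < k, 0 < C &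
  forall s, 1 <= s ->
    ((k * expR (- (C * s)))%:E <= P (X @^-1` `[s, (s + 1)%R]))%E].
Proof.
have [k [C [k0 C0 H]]] := inverse_gaussian_pdf_ge_exp m_gt0 l_gt0.
exists (k * expR (- C)), C; split => //; first by rewrite mulr_gt0 ?expR_gt0.
move=> s s1.
rewrite -[leRHS]/(distribution P X `[s, (s + 1)%R]%classic) law// /inverse_gaussian_prob.
apply: (@le_trans _ _ (\int[lebesgue_measure]_(x in `[s, (s + 1)%R])
    (k * expR (- (C * (s + 1))))%:E)%E).
  rewrite integral_cst// [X in (_ * X)%E](_ : _ = 1%E); last first.
    rewrite -[LHS]/(lebesgue_measure [set` `[s, s + 1]]) lebesgue_measure_itv/=.
    by rewrite lte_fin ltrDl ltr01 -EFinB addrAC subrr add0r.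
  by rewrite mule1 lee_fin -mulrA -expRD mulrDr mulr1 opprD addrC.
apply: ge0_le_integral => //.
- by move=> x _; rewrite lee_fin mulr_ge0 ?expR_ge0// ltW.
- apply/measurable_EFinP; apply: measurable_funTS.
  exact: measurable_inverse_gaussian_pdf.
- move=> x; rewrite /= in_itv/= => /andP[sx xs]; rewrite lee_fin.
  rewrite (le_trans _ (H x (le_trans s1 sx)))// ler_pM2l// ler_expR lerN2.
  by rewrite ler_pM2l.
Qed.

End InverseGaussianLaw.

Section ExponentialLaw.
Context d (T : measurableType d) (R : realType) (P : probability T R).
Variable X : {RV P >-> R}.
Hypothesis law : has_law P X (exponential_prob 1).

Lemma exponential_lt0 : P (X @^-1` `]-oo, 0[) = 0%E.
Proof.
rewrite -[LHS]/(distribution P X `]-oo, 0[%classic) law// /exponential_prob.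
rewrite integral0_eq// => x; rewrite /= in_itv/= => x0.
by rewrite lt0_exponential_pdf.
Qed.

Lemma exponential_light_tailed : light_tailed P X.
Proof.
apply: (@light_tailed_density _ _ _ _ X _ 1 1 _ _ _ _ law) => //.
- exact: measurable_exponential_pdf.
- by move=> x; exact: exponential_pdf_ge0.
- by move=> x; rewrite mul1r.
Qed.

End ExponentialLaw.

(** * Gamma integrals *)

Lemma cvg_invr_pinfty (R : realType) : (x : R)^-1 @[x --> +oo] --> (0 : R).
Proof.
have pos : \forall x \near +oo, 0 < (id x : R) by exact: nbhs_pinfty_gt.
exact: ((gtr0_cvgV0 pos).2 cvg_id).
Qed.

Lemma cvg_exprn_expRN (R : realType) (r : R) n : 0 < r ->
  x ^+ n * expR (- (r * x)) @[x --> +oo] --> (0 : R).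
Proof.
move=> r0; pose K : R := n.+1`!%:R / r ^+ n.+1.
have K0 : 0 < K by rewrite divr_gt0 ?exprn_gt0// ltr0n fact_gt0.
apply: (squeeze_cvgr (f := fun=> 0) (h := fun x => K * x^-1)); [|exact: cvg_cst|]; last first.
  rewrite -[X in _ --> X](mulr0 K); apply: cvgM; first exact: cvg_cst.
  exact: cvg_invr_pinfty.
near=> x.
have x0 : 0 < x by near: x; exact: nbhs_pinfty_gt.
rewrite mulr_ge0 ?expR_ge0 ?exprn_ge0 ?(ltW x0)//=.
rewrite expRN ler_pdivrMr ?expR_gt0//.
have rx0 : 0 <= r * x by rewrite mulr_ge0 ?ltW.
have := @expR_ge1Dxn R (r * x) n rx0.
have f0 : 0 < n.+1`!%:R :> R by rewrite ltr0n fact_gt0.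
move=> /(le_trans (ltW (ltr_pwDl ltr01 (lexx _)))).
rewrite ler_pdivrMr// => h.
have rn : r ^+ n.+1 != 0 by rewrite expf_neq0// gt_eqF.
have xn : x != 0 by rewrite gt_eqF.
have -> : x ^+ n = (r * x) ^+ n.+1 / (r ^+ n.+1 * x).
  by rewrite exprMn [x ^+ n.+1]exprS; field; rewrite rn xn.
have -> : K * x^-1 * expR (r * x) = expR (r * x) * n.+1`!%:R / (r ^+ n.+1 * x).
  by rewrite /K; field; rewrite rn xn.
by rewrite ler_pM2r// invr_gt0 mulr_gt0// exprn_gt0.
Unshelve. all: by end_near. Qed.

Lemma cvg_poly_expRN (R : realType) (r : R) (p : {poly R}) : 0 < r ->
  p.[x] * expR (- (r * x)) @[x --> +oo] --> (0 : R).
Proof.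
move=> r0.
rewrite [X in X @ _](_ : _ = fun x => \sum_(i < size p) p`_i * (x ^+ i * expR (- (r * x)))); last first.
  apply/funext => x; rewrite horner_coef mulr_suml.
  by apply: eq_bigr => i _; rewrite mulrA.
elim: (size p) => [|n IH].
  by under eq_fun do rewrite big_ord0; exact: cvg_cst.
rewrite [X in X @ _](_ : _ = fun x =>
  \sum_(i < n) p`_i * (x ^+ i * expR (- (r * x))) +
  p`_n * (x ^+ n * expR (- (r * x)))); last first.
  by apply/funext => x; rewrite big_ord_recr.
rewrite -[X in _ --> X]addr0.
apply: cvgD; first exact: IH.
rewrite -[X in _ --> X](mulr0 p`_n); apply: cvgM; first exact: cvg_cst.
exact: cvg_exprn_expRN.
Qed.

Lemma is_derive_expRN (R : realType) (r x : R) :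
  is_derive x 1 (fun y : R => expR (- (r * y))) (- r * expR (- (r * x))).
Proof.
apply: is_derive_eq.
by rewrite mulrC; congr (- _ * _); exact: mulr1.
Qed.

Section GammaIntegral.
Context (R : realType) (r : R).
Hypothesis r_gt0 : 0 < r.

(** The polynomial part of the incomplete gamma function, in the form that makes
- g x exp (- r x) a primitive of r x^k exp (- r x). *)
Fixpoint gamma_poly (k : nat) : {poly R} :=
  if k is k'.+1 then 'X^k + (k%:R / r) *: gamma_poly k' else 1.

Lemma gamma_polyE k : r *: gamma_poly k - (gamma_poly k)^`() = r *: 'X^k.
Proof.
have rn : r != 0 by rewrite gt_eqF.
elim: k => [|k IH] /=; first by rewrite derivC subr0 expr0.
rewrite derivD derivZ derivXn /= scalerDr.
have -> : (gamma_poly k)^`() = r *: gamma_poly k - r *: 'X^k by rewrite -IH opprB addrC subrK.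
rewrite scalerBr !scalerA (mulrC r) !divfK// !scaler_nat.
by move: (r *: _) (gamma_poly k) => a g; ring.
Qed.

Lemma is_derive_gamma k (x : R) :
  is_derive x 1 (fun y => - ((gamma_poly k).[y] * expR (- (r * y))))
    (x ^+ k * (r * expR (- (r * x)))).
Proof.
set E := expR (- (r * x)).
have dE := is_derive_expRN r x.
have dp := is_derive_poly (gamma_poly k) x.
apply: (is_derive_eq (is_deriveN (is_deriveM dp dE))).
rewrite -[_ *: _ + _]/(_ * _ + _ * _) -/E.
have := congr1 (horner^~ x) (gamma_polyE k).
rewrite hornerD hornerN !hornerZ hornerXn => H.
transitivity ((r * (gamma_poly k).[x] - (gamma_poly k)^`().[x]) * E); first by ring.
by rewrite H; ring.
Qed.

Lemma gamma_poly0 k : (gamma_poly k).[0] = k`!%:R / r ^+ k.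
Proof.
have rn : r != 0 by rewrite gt_eqF.
elim: k => [|k IH] /=; first by rewrite hornerC fact0 expr0 divr1.
rewrite hornerD hornerXn expr0n add0r hornerZ IH factS natrM exprS.
by field; rewrite rn expf_neq0.
Qed.

Lemma integral_gamma k :
  (\int[lebesgue_measure]_(x in `[0%R, +oo[) (x ^+ k * (r * expR (- (r * x))))%:E =
   (k`!%:R / r ^+ k)%:E)%E.
Proof.
pose F y := - ((gamma_poly k).[y] * expR (- (r * y))).
have dF (x : R) : is_derive x 1 F (x ^+ k * (r * expR (- (r * x)))) := is_derive_gamma k x.
have cF : continuous F.
  by move=> x; apply: differentiable_continuous; apply/derivable1_diffP.
rewrite (@ge0_continuous_FTC2y _ _ F _ 0).
- by rewrite /F mulr0 oppr0 expR0 mulr1 gamma_poly0 -EFinB sub0r opprK.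
- by move=> x x0; rewrite !mulr_ge0 ?exprn_ge0 ?expR_ge0 ?(ltW r_gt0).
- apply: continuous_subspaceT => x; apply: cvgM; first exact: exprn_continuous.
  apply: cvgM; first exact: cvg_cst.
  apply: (@cvg_comp _ _ _ (fun y => - (r * y)) (@expR R)); last exact: continuous_expR.
  by apply: cvgN; apply: cvgM => //; exact: cvg_cst.
- by rewrite -oppr0; apply: cvgN; exact: cvg_poly_expRN.
- by move=> x _; exact: ex_derive.
- by apply: cvg_at_right_filter; exact: cF.
- by move=> x _; rewrite derive1E; exact: derive_val.
Qed.

End GammaIntegral.

(** * An oscillation orthogonal to all polynomials *)

Section Oscillation.
Context (R : realType).
Local Notation w := (Num.sqrt 3 / 2 : R).

Let w2 : w * w = 3 / 4.
Proof.
have s3 : Num.sqrt 3 * Num.sqrt 3 = 3 :> R by rewrite -expr2 sqr_sqrtr.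
by rewrite mulrACA s3; field.
Qed.

(** The real combinations of the real and imaginary parts of exp (j u), where
j = - 1/2 + i sqrt 3 / 2 is a primitive cube root of unity: a plane that is stable
under differentiation, on which the third derivative is the identity. *)
Definition wave (a b u : R) : R :=
  (a * cos (w * u) + b * sin (w * u)) * expR (- (2^-1 * u)).

Lemma is_derive_wave (a b u : R) :
  is_derive u 1 (wave a b) (wave (b * w - a / 2) (- (a * w + b / 2)) u).
Proof.
have dsin : is_derive u 1 (fun y : R => sin (w * y)) (w * cos (w * u)).
  apply: is_derive_eq; rewrite mulrC; congr (_ * _); exact: mulr1.
have dcos : is_derive u 1 (fun y : R => cos (w * y)) (- (w * sin (w * u))).
  apply: is_derive_eq; rewrite mulNr mulrC; congr (- (_ * _)); exact: mulr1.
apply: (is_derive_eq (is_deriveM (is_deriveD (is_deriveZ a dcos)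
  (is_deriveZ b dsin)) (is_derive_expRN 2^-1 u))).
rewrite -[_ *: _ + _ *: _]/(_ * _ + _ * _).
rewrite -[_ *: - _]/(_ * - _) -[_ *: (w * _)]/(_ * (w * _)).
rewrite -[(_ + _) u]/(a * cos (w * u) + b * sin (w * u)) /wave.
by move: w => v; field.
Qed.

Lemma norm_wave_le (a b u : R) : `|wave a b u| <= (`|a| + `|b|) * expR (- (2^-1 * u)).
Proof.
rewrite normrM (ger0_norm (expR_ge0 _)) ler_wpM2r ?expR_ge0//.
rewrite (le_trans (ler_normD _ _))// !normrM lerD// ler_piMr//.
  by rewrite ler_norml cos_geN1 cos_le1.
by rewrite ler_norml sin_geN1 sin_le1.
Qed.

(** The imaginary part of exp (j u). *)
Definition osc : R -> R := wave 0 1.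

Lemma is_derive_osc (u : R) : is_derive u 1 osc (wave w (- 2^-1) u).
Proof.
apply: (is_derive_eq (is_derive_wave 0 1 u)).
by congr (wave _ _ _); move: w => v; field.
Qed.

Lemma is_derive_osc1 (u : R) :
  is_derive u 1 (wave w (- 2^-1)) (wave (- w) (- 2^-1) u).
Proof.
apply: (is_derive_eq (is_derive_wave w (- 2^-1) u)).
congr (wave _ _ _); first by move: w => v; field.
by rewrite w2; field.
Qed.

Lemma is_derive_osc2 (u : R) : is_derive u 1 (wave (- w) (- 2^-1)) (osc u).
Proof.
apply: (is_derive_eq (is_derive_wave (- w) (- 2^-1) u)).
congr (wave _ _ _); first by move: w => v; field.
by rewrite mulNr w2; field.
Qed.

(** Three integrations by parts. Since osc is its own third derivative, its successive
primitives are its second derivative, its first derivative and itself. *)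
Definition osc_primitive (q : {poly R}) (u : R) : R :=
  q.[u] * wave (- w) (- 2^-1) u - q^`().[u] * wave w (- 2^-1) u
  + q^`()^`().[u] * osc u.

Lemma is_derive_osc_primitive q (u : R) :
  is_derive u 1 (osc_primitive q) ((q + q^`()^`()^`()).[u] * osc u).
Proof.
apply: (is_derive_eq (is_deriveD (is_deriveB
  (is_deriveM (is_derive_poly q u) (is_derive_osc2 u))
  (is_deriveM (is_derive_poly q^`() u) (is_derive_osc1 u)))
  (is_deriveM (is_derive_poly q^`()^`() u) (is_derive_osc u)))).
rewrite -![_ *: _]/(_ * _) hornerD.
move: (wave _ _ u) (wave _ _ u) (osc u) => A B C; ring.
Qed.

Lemma osc_primitive_cvg_pinfty q : osc_primitive q u @[u --> +oo] --> (0 : R).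
Proof.
have half0 : 0 < 2^-1 :> R by rewrite invr_gt0.
have wave0 (p : {poly R}) a b : p.[u] * wave a b u @[u --> +oo] --> (0 : R).
  pose h (u : R) := (`|a| + `|b|) * `|p.[u] * expR (- (2^-1 * u))|.
  have h0 : h u @[u --> +oo] --> (0 : R).
    rewrite -[X in _ --> X](mulr0 (`|a| + `|b|)); apply: cvgM; first exact: cvg_cst.
    by rewrite -(@normr0 R R); apply: cvg_norm; exact: cvg_poly_expRN.
  apply: (squeeze_cvgr (f := fun u => - h u) (h := h)); last 2 first.
  - by rewrite -oppr0; exact: cvgN.
  - exact: h0.
  apply: nearW => u; rewrite -ler_norml /h normrM [`|p.[u] * expR _|]normrM.
  by rewrite (ger0_norm (expR_ge0 _)) [leRHS]mulrCA ler_wpM2l// norm_wave_le.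
rewrite [X in _ --> X](_ : 0 = 0 - 0 + 0); last by rewrite subr0 addr0.
by apply: cvgD; [apply: cvgB|]; exact: wave0.
Qed.

(** The solution q of q + q''' = X^(3 k + 2). The degrees go down by three and end at
2, so q and q' vanish at 0; this is the place where the exponent 3 k + 2, brought by
the change of variable x = u^3 in x^k dx, is essential. *)
Fixpoint osc_poly (k : nat) : {poly R} :=
  if k is k'.+1 then
    'X^(3 * k + 2) -
    ((3 * k + 2) * (3 * k + 1) * (3 * k))%:R *: osc_poly k'
  else 'X^2.

Lemma osc_polyE k : osc_poly k + (osc_poly k)^`()^`()^`() = 'X^(3 * k + 2).
Proof.
elim: k => [|k IH].
  by rewrite muln0 add0n /= derivXn /= derivMn derivX !derivMn derivC !mul0rn addr0.
rewrite [osc_poly k.+1]/=; set c := (_ * _)%N.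
rewrite !(derivB, derivZ) -/(_^`()).
rewrite addrACA -opprD -scalerDr IH.
have -> : (3 * k.+1 + 2 = (3 * k + 2).+3)%N by lia.
rewrite !(derivXn, derivMn) /= scaler_nat -!mulrnA.
have -> : ((3 * k + 2).+1 * ((3 * k + 2).+2 * (3 * k + 2).+3) =
  (3 * k + 2).+3 * (c + 1) * c)%N by rewrite /c; lia.
by rewrite addrK.
Qed.

Lemma osc_poly0 k : (osc_poly k).[0] = 0 /\ (osc_poly k)^`().[0] = 0.
Proof.
elim: k => [|k [IH1 IH2]] /=.
  by rewrite derivXn hornerXn hornerMn hornerX /= expr0n mul0rn.
rewrite derivB derivZ derivXn !(hornerD, hornerN, hornerZ, hornerMn) !hornerXn IH1 IH2.
by rewrite !mulr0 !subr0 addn2 /= !expr0n /= mulnSr addn3 /= mul0rn.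
Qed.

(** The third term of the primitive vanishes because osc itself does at 0. *)
Lemma osc_primitive0 k : osc_primitive (osc_poly k) 0 = 0.
Proof.
have [q0 dq0] := osc_poly0 k.
by rewrite /osc_primitive q0 dq0 !mul0r subr0 add0r /osc /wave mulr0 sin0 mul0r mulr0 addr0 mul0r mulr0.
Qed.

End Oscillation.

Section CubeRootOscillation.
Context (R : realType).
Local Notation cubert x := (x `^ 3^-1).

Lemma cubert_cube (y : R) : 0 <= y -> cubert (y ^+ 3) = y.
Proof.
by move=> y0; rewrite -powR_mulrn// -powRrM divff// powRr1.
Qed.

Lemma cube_cubert (x : R) : 0 <= x -> (cubert x) ^+ 3 = x.
Proof.
by move=> x0; rewrite -powR_mulrn ?powR_ge0// -powRrM mulVf// powRr1.
Qed.

Lemma norm_osc_le (u : R) : `|osc u| <= expR (- (2^-1 * u)).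
Proof.
by rewrite (le_trans (norm_wave_le _ _ _))// normr0 add0r normr1 mul1r.
Qed.

Lemma continuous_osc : continuous (@osc R).
Proof.
move=> u; apply: differentiable_continuous; apply/derivable1_diffP.
by have := is_derive_osc u => -[].
Qed.

(** On this interval the argument sqrt 3 / 2 u of the sine is between 0 and
sqrt 3 < 2 <= pi. *)
Lemma osc_gt0 (u : R) : 1 <= u <= 2 -> 0 < osc u.
Proof.
move=> /andP[u1 u2].
have s3 : Num.sqrt 3 * Num.sqrt 3 = 3 :> R by rewrite -expr2 sqr_sqrtr.
have s0 : 0 < Num.sqrt 3 :> R by rewrite sqrtr_gt0.
have s2 : Num.sqrt 3 < 2 :> R by nra.
rewrite /osc /wave mul0r add0r mul1r mulr_gt0 ?expR_gt0// sin_gt0_pi//.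
apply/andP; split; first by rewrite !mulr_gt0// (lt_le_trans _ u1).
apply: lt_le_trans (pi_ge2 R).
by move: (Num.sqrt 3) s0 s2 => s s0 s2; nra.
Qed.

Lemma osc_ge_cst : exists2 e : R, 0 < e & forall u, 1 <= u <= 2 -> e <= osc u.
Proof.
have [] := @EVT_min R (@osc R) 1 2.
- by rewrite ler1n.
- by apply: continuous_subspaceT; exact: continuous_osc.
move=> c; rewrite in_itv/= => c12 H; exists (osc c); first exact: osc_gt0.
by move=> u u12; apply: H; rewrite in_itv.
Qed.

Lemma is_derive_cubert (x : R) : 0 < x ->
  is_derive x 1 (fun y : R => cubert y) ((3 * cubert x ^+ 2)^-1).
Proof.
move=> x0; apply: (is_derive_eq (is_derive1_powR 3^-1 x0)).
have t0 : 0 < cubert x by exact: powR_gt0.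
rewrite powRB; last by rewrite (gt_eqF x0); apply/implybT.
rewrite powRr1 ?(ltW x0)// -[X in _ / X](cube_cubert (ltW x0)).
by field; rewrite gt_eqF.
Qed.

Variable b : R.
Hypothesis b_gt0 : 0 < b.

Definition osc_cubert (x : R) : R := osc (b * cubert x).

(* The primitive in the variable u = b x^(1/3). *)
Let F k (x : R) : R := 3 / b ^+ (3 * k + 3) * osc_primitive (osc_poly R k) (b * cubert x).

Let dF k (x : R) : 0 < x -> is_derive x 1 (F k) (x ^+ k * osc_cubert x).
Proof.
move=> x0; have t0 : 0 < cubert x by exact: powR_gt0.
have dg : is_derive x 1 (fun y => b * cubert y) (b * (3 * cubert x ^+ 2)^-1).
  exact: (is_deriveZ b (is_derive_cubert x0)).
have dH := is_derive_osc_primitive (osc_poly R k) (b * cubert x).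
have dHg : is_derive x 1 (fun y => osc_primitive (osc_poly R k) (b * cubert y)) _ :=
  @is_derive1_comp R _ (fun y => b * cubert y) x _ _ dH dg.
apply: (is_derive_eq (is_deriveZ (3 / b ^+ (3 * k + 3)) dHg)).
rewrite -[_ *: _]/(_ * _) osc_polyE hornerXn -/(osc_cubert x).
have -> : x ^+ k = cubert x ^+ (3 * k) by rewrite exprM cube_cubert// ltW.
rewrite exprMn 2!(exprD b (3 * k)%N) (exprD (cubert x) (3 * k)%N) -/(osc_cubert x).
move: (osc_cubert x) (cubert x) t0 => g t t0.
have B0 : b ^+ (3 * k) != 0 by rewrite expf_neq0// gt_eqF.
move: (b ^+ (3 * k)) B0 (t ^+ (3 * k)) => B B0 A.
by field; rewrite B0 !gt_eqF.
Qed.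

Lemma norm_osc_cubert_le (x : R) : `|osc_cubert x| <= expR (- (b / 2 * cubert x)).
Proof.
rewrite (le_trans (norm_osc_le _))// ler_expR lerN2 le_eqVlt; apply/orP; left.
by apply/eqP; field.
Qed.

Lemma measurable_osc_cubert : measurable_fun setT osc_cubert.
Proof.
apply: (@measurableT_comp _ _ _ _ _ _ (@osc R)).
  exact: continuous_measurable_fun continuous_osc.
by apply: measurable_funM => //; exact: measurable_powR.
Qed.

(** In the variable u = b x^(1/3) the integrand is, up to a constant,
u^(3 k + 2) osc u, whose primitive vanishes both at 0 and at infinity. *)
Lemma osc_cubert_moment k :
  lebesgue_measure.-integrable `]0%R, +oo[
    (fun x : R => (x ^+ k * osc_cubert x)%:E) ->
  (\int[lebesgue_measure]_(x in `]0%R, +oo[) (x ^+ k * osc_cubert x)%:E = 0)%E.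
Proof.
move=> fint; pose f (x : R) := x ^+ k * osc_cubert x.
(* The half-line is exhausted by intervals whose endpoints have the simple cube
   roots 1 / N and N. *)
pose N n : R := n.+2%:R.
have N1 n : 1 < N n by rewrite ltr1n.
have N0 n : 0 < N n by exact: lt_trans (N1 n).
pose a n := (N n)^-1 ^+ 3; pose c n := N n ^+ 3.
have a0 n : 0 < a n by rewrite exprn_gt0// invr_gt0.
have ac n : a n < c n.
  rewrite (@lt_trans _ _ 1)//; first by rewrite exprn_ilt1// ?invr_ge0 ?ltW// invf_lt1.
  by rewrite exprn_egt1.
have FTC n : (\int[lebesgue_measure]_(x in `[a n, c n]) (f x)%:E =
    (F k (c n))%:E - (F k (a n))%:E)%E.
  have cF x : 0 < x -> {for x, continuous (F k)}.
    by move=> x0; apply: differentiable_continuous; apply/derivable1_diffP; case: (dF k x0).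
  apply: continuous_FTC2 => //.
  - apply: continuous_in_subspaceT => x; rewrite inE/= in_itv/= => /andP[ax _].
    have x0 : 0 < x by exact: lt_le_trans ax.
    apply: cvgM; first exact: exprn_continuous.
    apply: (@cvg_comp _ _ _ (fun y => b * cubert y) (@osc R)); last exact: continuous_osc.
    apply: cvgM; first exact: cvg_cst.
    have cc : {for x, continuous (fun y => cubert y)}.
      apply: differentiable_continuous; apply/derivable1_diffP.
      by case: (is_derive_cubert x0).
    exact: cc.
  - split.
    + move=> x; rewrite in_itv/= => /andP[ax _].
      by case: (dF k (lt_trans (a0 n) ax)).
    + by apply: cvg_at_right_filter; exact: cF.
    + by apply: cvg_at_left_filter; apply: cF; exact: lt_trans (ac n).
  - move=> x; rewrite in_itv/= => /andP[ax _]; rewrite derive1E.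
    by case: (dF k (lt_trans (a0 n) ax)).
have N_pinfty : N n @[n --> \oo] --> +oo.
  apply/cvgryPge => A; near=> n; apply: (@le_trans _ _ n%:R).
    by near: n; exact: nbhs_infty_ger.
  by rewrite ler_nat -addn2 leq_addr.
have Fc : F k (c n) @[n --> \oo] --> (0 : R).
  rewrite /F -[X in _ --> X](mulr0 (3 / b ^+ (3 * k + 3))).
  apply: cvgM; first exact: cvg_cst.
  under eq_fun do rewrite cubert_cube ?(ltW (N0 _))//.
  have bN : b * N n @[n --> \oo] --> +oo.
    apply/cvgryPge => A; near=> n; rewrite mulrC -ler_pdivrMr//.
    by near: n; move/cvgryPge : N_pinfty; apply.
  exact: (cvg_comp _ _ bN (@osc_primitive_cvg_pinfty R (osc_poly R k))).
have Fa : F k (a n) @[n --> \oo] --> (0 : R).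
  rewrite /F -[X in _ --> X](mulr0 (3 / b ^+ (3 * k + 3))).
  apply: cvgM; first exact: cvg_cst.
  under eq_fun do rewrite cubert_cube ?invr_ge0 ?(ltW (N0 _))//.
  have bN : b * (N n)^-1 @[n --> \oo] --> (0 : R).
    rewrite -[X in _ --> X](mulr0 b); apply: cvgM; first exact: cvg_cst.
    exact: (cvg_comp _ _ N_pinfty (@cvg_invr_pinfty R)).
  have H0 : {for 0, continuous (osc_primitive (osc_poly R k))}.
    apply: differentiable_continuous; apply/derivable1_diffP.
    by case: (is_derive_osc_primitive (osc_poly R k) 0).
  by have := cvg_comp _ _ bN H0; rewrite osc_primitive0.
have cvgB0 (u v : nat -> R) : u n @[n --> \oo] --> (0 : R) ->
    v n @[n --> \oo] --> (0 : R) -> ((u n)%:E - (v n)%:E @[n --> \oo] --> 0)%E.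
  move=> u0 v0; have := cvgB u0 v0; rewrite subr0 => uv0.
  by apply: cvg_EFin; [exact: nearW|exact: uv0].
have lim0 : (\int[lebesgue_measure]_(x in `[a n, c n]) (f x)%:E @[n --> \oo] --> 0)%E.
  rewrite (_ : (fun n => _) = fun n => ((F k (c n))%:E - (F k (a n))%:E)%E).
    exact: cvgB0 Fc Fa.
  by apply/funext => n; rewrite FTC.
apply: cvg_unique lim0 => //.
have sub n : `[a n, c n] `<=` `]0%R, +oo[.
  move=> x /=; rewrite !in_itv/= andbT => /andP[+ _]; exact: lt_le_trans.
have mf : measurable_fun setT f.
  by apply: measurable_funM => //; exact: measurable_osc_cubert.
rewrite /= [X in X @ _](_ : _ = fun n => (\int[lebesgue_measure]_(x in `]0%R, +oo[)
    ((EFin \o f) \_ `[a n, c n]) x)%E); last first.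
  by apply/funext => n; rewrite -integral_mkcondr setIidr//; exact: sub.
apply: (@dominated_cvg _ (measurableTypeR R) R lebesgue_measure `]0%R, +oo[%classic
  _ (fun n => (EFin \o f) \_ `[a n, c n]) (EFin \o f)
  (fun x => `|(f x)%:E|%E)) => //.
- move=> n; apply/measurable_restrict => //.
  by apply: measurable_funTS; exact/measurable_EFinP.
- move=> x; rewrite /= in_itv/= andbT => x0.
  apply: cvg_near_cst; near=> n; rewrite patchE mem_set//= in_itv/=.
  have N3 : N n <= N n ^+ 3.
    by rewrite exprS ler_peMr ?(ltW (N0 n))// exprn_ege1// ltW.
  have xN : x <= N n.
    by near: n; move/cvgryPge : N_pinfty; apply.
  have xN' : x^-1 <= N n.
    by near: n; move/cvgryPge : N_pinfty; apply.
  rewrite (le_trans xN N3) andbT /a exprVn -[leRHS]invrK lef_pV2 ?posrE ?invr_gt0 ?exprn_gt0//.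
  exact: le_trans xN' N3.
- exact: integrable_abse.
- move=> n x _; rewrite patchE; case: ifPn => // _.
  by rewrite abse0.
Unshelve. all: by end_near. Qed.

End CubeRootOscillation.

(** * Independence and products *)

Section IndependentProduct.
Context d (T : measurableType d) (R : realType) (P : probability T R).

Lemma ge0_integralM_independent (X Y : {RV P >-> R}) (f g : R -> \bar R) :
  (forall A B : set R, measurable A -> measurable B ->
    P (X @^-1` A `&` Y @^-1` B) = (P (X @^-1` A) * P (Y @^-1` B))%E) ->
  measurable_fun setT f -> measurable_fun setT g ->
  (forall x, 0 <= f x)%E -> (forall x, 0 <= g x)%E ->
  (\int[P]_w (f (X w) * g (Y w)) = \int[P]_w f (X w) * \int[P]_w g (Y w))%E.
Proof.
move=> indep mf mg f0 g0.
have mXY : measurable_fun setT (fun w => (X w, Y w)) by exact: measurable_fun_pair.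
pose XY : {mfun T >-> (R * R)%type} :=
  HB.pack (fun w => (X w, Y w)) (isMeasurableFun.Build _ _ _ _ _ mXY).
pose h (z : R * R) := (f z.1 * g z.2)%E.
have mh : measurable_fun setT h.
  by apply: emeasurable_funM; [exact: (measurableT_comp mf)|exact: (measurableT_comp mg)].
have h0 z : (0 <= h z)%E by rewrite mule_ge0.
rewrite -[LHS](ge0_integral_distribution XY mh h0).
transitivity (\int[(distribution P X \x distribution P Y)%E]_z h z)%E.
  apply: eq_measure_integral => A mA _; apply/esym.
  have XYE B C : measurable B -> measurable C ->
      distribution P XY (B `*` C) = (distribution P X B * distribution P Y C)%E.
    by move=> mB mC; rewrite -[RHS]indep.
  exact: (@product_measure_unique _ _ R R R (distribution P X) (distribution P Y)
    (distribution P XY) XYE A mA).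
rewrite fubini_tonelli1//.
under eq_integral do rewrite /fubini_F /h/= ge0_integralZl//.
rewrite ge0_integralZr//; last exact: integral_ge0.
by rewrite !ge0_integral_distribution.
Qed.

Lemma independent3_fst2 (X Y Z : {RV P >-> R}) : independent3 P X Y Z ->
  forall A B : set R, measurable A -> measurable B ->
    P (X @^-1` A `&` Y @^-1` B) = (P (X @^-1` A) * P (Y @^-1` B))%E.
Proof.
move=> indep A B mA mB; have := indep A B setT mA mB measurableT.
by rewrite preimage_setT setIT probability_setT mule1.
Qed.

(** Both sides are measures of the Borel set of pairs whose product is in A, and they
agree on rectangles by the product rule for three variables. *)
Lemma independent3_mul (X Y Z : {RV P >-> R}) : independent3 P X Y Z ->
  forall A B : set R, measurable A -> measurable B ->
    P ((X \* Y) @^-1` A `&` Z @^-1` B) = (P ((X \* Y)%R @^-1` A) * P (Z @^-1` B))%E.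
Proof.
move=> indep A B mA mB.
have mXY : measurable_fun setT (fun w => (X w, Y w)) by exact: measurable_fun_pair.
have mZB : measurable (Z @^-1` B) by exact: measurable_funPTI.
have fin : P (Z @^-1` B) \is a fin_num by exact: fin_num_measure.
have ge0 : (0 <= fine (P (Z @^-1` B)))%R by rewrite fine_ge0.
pose XY : T -> R * R := fun w => (X w, Y w).
pose m1_ : {measure set (R * R)%type -> \bar R} := pushforward (mrestr P mZB) XY.
pose m2_ : {measure set (R * R)%type -> \bar R} :=
  mscale (NngNum ge0) (pushforward P XY).
have m12E C : measurable C -> m1_ mXY C = m2_ mXY C.
  move=> mC.
  apply: (@measure_unique _ R _
    [set C1 `*` C2 | C1 in measurable & C2 in measurable]
    (fun=> setT) _ _ _ _ (m1_ mXY) (m2_ mXY)) => //.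
  - exact: measurable_prod_measurableType.
  - move=> _ _ [A1 mA1 [A2 mA2 <-]] [B1 mB1 [B2 mB2 <-]].
    by rewrite -setXI; exists (A1 `&` B1); [exact: measurableI|exists (A2 `&` B2) => //; exact: measurableI].
  - by move=> _; exists setT => //; exists setT => //; rewrite setXTT.
  - by rewrite bigcup_const.
  - move=> _ [C1 mC1 [C2 mC2 <-]].
    rewrite -[LHS]/(P ((X @^-1` C1 `&` Y @^-1` C2) `&` Z @^-1` B)) indep//.
    rewrite -[RHS]/((fine (P (Z @^-1` B)))%:E * P (X @^-1` C1 `&` Y @^-1` C2))%E.
    by rewrite fineK// (independent3_fst2 indep)// muleC.
  - move=> _; rewrite -[ltLHS]/(P (XY @^-1` setT `&` Z @^-1` B)).
    by rewrite preimage_setT setTI ltey_eq fin.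
have mM : measurable_fun setT (fun z : R * R => z.1 * z.2).
  by apply: measurable_funM; [exact: measurable_fst|exact: measurable_snd].
have mC : measurable ((fun z : R * R => z.1 * z.2) @^-1` A).
  by rewrite -[X in measurable X]setTI; exact: mM.
have := m12E _ mC.
rewrite -[LHS]/(P ((X \* Y) @^-1` A `&` Z @^-1` B)) => ->.
rewrite -[LHS]/((fine (P (Z @^-1` B)))%:E * P ((X \* Y)%R @^-1` A))%E.
by rewrite fineK// muleC.
Qed.

End IndependentProduct.

(** * Two densities with the same moments *)

Lemma density_probability (R : realType) (q : R -> R) :
  measurable_fun setT q -> (forall x, 0 <= q x) ->
  (\int[lebesgue_measure]_x (q x)%:E = 1)%E ->
  exists nu : probability R R, forall A : set R,
    nu A = (\int[lebesgue_measure]_(x in A) (q x)%:E)%E.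
Proof.
move=> mq q0 q1.
pose nu (A : set R) : \bar R := (\int[lebesgue_measure]_(x in A) (q x)%:E)%E.
have nu0 : nu set0 = 0%E by exact: integral_set0.
have nu_ge0 A : (0 <= nu A)%E by apply: integral_ge0 => x _; rewrite lee_fin.
have nu_add : semi_sigma_additive nu.
  move=> F mF tF mUF; rewrite /nu; apply: cvg_toP.
    apply: ereal_nondecreasing_is_cvgn => m n mn.
    by apply: lee_sum_nneg_natr => // k _ _; exact: nu_ge0.
  rewrite ge0_integral_bigcup//=.
  - by apply/measurable_funTS/measurable_EFinP.
  - by move=> x _; rewrite lee_fin.
pose mnu : {measure set R -> \bar R} :=
  HB.pack nu (isMeasure.Build _ _ _ nu nu0 nu_ge0 nu_add).
pose pnu : probability R R :=
  HB.pack (mnu : set R -> \bar R) (Measure.on mnu) (Measure_isProbability.Build _ _ R mnu q1).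
by exists pnu.
Qed.

Lemma integral_exprn_norm d (T : measurableType d) (R : realType)
    (P : probability T R) (X : T -> R) k : measurable_fun setT X ->
  P (X @^-1` `]-oo, 0[) = 0%E ->
  (\int[P]_w (X w ^+ k)%:E = \int[P]_w (`|X w| ^+ k)%:E)%E.
Proof.
move=> mX X0; apply: ae_eq_integral => //.
- by apply/measurable_EFinP; exact: measurable_funX.
- by apply/measurable_EFinP; apply: measurable_funX; exact: measurableT_comp.
exists (X @^-1` `]-oo, 0[); split => //.
  by rewrite -[X in measurable X]setTI; exact: mX.
move=> w /= H; rewrite in_itv/=; have [//|w0] := ltP (X w) 0.
by exfalso; apply: H => _; rewrite ger0_norm.
Qed.

Section Competitors.
Context (R : realType) (h : R -> R) (M : nat -> R) (k0 B : R).
Hypothesis mh : measurable_fun setT h.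
Hypothesis h_moment : forall k : nat,
  (\int[lebesgue_measure]_(x in `]0%R, +oo[) (x ^+ k * h x)%:E = (M k)%:E)%E.
Hypothesis M0 : M 0 = 1.
Hypotheses (k0_gt0 : 0 < k0) (B_gt0 : 0 < B).
Hypothesis h_ge : forall x, 0 < x -> k0 * expR (- (B * x `^ 3^-1)) <= h x.

Local Notation g := (osc_cubert (2 * B)).

(** The rate 2 B makes g bounded by exp (- B x^(1/3)), so that k0 g stays below h. *)
Definition perturbed (s : R) : R -> R := (fun x => h x + s * (k0 * g x)) \_ `]0, +oo[.

Let b_gt0 : 0 < 2 * B. Proof. by rewrite mulr_gt0. Qed.

Let h_ge0 x : 0 < x -> 0 <= h x.
Proof.
by move=> x0; rewrite (le_trans _ (h_ge x0))// mulr_ge0 ?expR_ge0// ltW.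
Qed.

Let g_le x : 0 < x -> `|k0 * g x| <= h x.
Proof.
move=> x0; rewrite normrM (gtr0_norm k0_gt0) (le_trans _ (h_ge x0))// ler_pM2l//.
rewrite (le_trans (norm_osc_cubert_le _ _))// le_eqVlt; apply/orP; left; apply/eqP.
by congr expR; field.
Qed.

Let mg : measurable_fun setT g. Proof. exact: measurable_osc_cubert. Qed.

Let perturbedE s x : 0 < x -> perturbed s x = h x + s * (k0 * g x).
Proof. by move=> x0; rewrite /perturbed patchE mem_set//= in_itv/= x0. Qed.

Let perturbed_le0 s x : x <= 0 -> perturbed s x = 0.
Proof.
by move=> x0; rewrite /perturbed patchE memNset//= in_itv/= andbT; apply/negP; rewrite -leNgt.
Qed.

Let perturbed_ge0 s x : `|s| <= 1 -> 0 <= perturbed s x.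
Proof.
move=> s1; have [x0|x0] := leP x 0; first by rewrite perturbed_le0.
have : `|s * (k0 * g x)| <= h x.
  by rewrite normrM (le_trans _ (g_le x0))// ler_piMl.
by rewrite perturbedE// ler_norml => /andP[? _]; lra.
Qed.

Let measurable_perturbed s : measurable_fun setT (perturbed s).
Proof.
apply/measurable_restrict => //; apply: measurable_funTS.
apply: measurable_funD => //; apply: measurable_funM => //.
exact: measurable_funM.
Qed.

Let mhk k : measurable_fun setT (fun x : R => (x ^+ k * h x)%:E).
Proof. by apply/measurable_EFinP; apply: measurable_funM => //; exact: measurable_funX. Qed.

Let h_integrable k :
  lebesgue_measure.-integrable `]0%R, +oo[ (fun x : R => (x ^+ k * h x)%:E).
Proof.
apply/integrableP; split; first by apply: measurable_funTS; exact: mhk.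
rewrite [ltLHS](_ : _ = (M k)%:E) ?ltry// -h_moment; apply: eq_integral => x.
rewrite inE/= in_itv/= andbT => x0.
by rewrite ger0_norm// mulr_ge0 ?h_ge0// exprn_ge0// ltW.
Qed.

Let g_integrable k :
  lebesgue_measure.-integrable `]0%R, +oo[ (fun x : R => (x ^+ k * g x)%:E).
Proof.
apply: (@le_integrable _ (measurableTypeR R) R lebesgue_measure `]0%R, +oo[ _ _ (fun x : R => (k0^-1)%:E * (x ^+ k * h x)%:E)%E) => //.
- apply: measurable_funTS; apply/measurable_EFinP; exact: measurable_funM.
- move=> x; rewrite /= in_itv/= andbT => x0; rewrite lee_fin.
  have xk0 : 0 <= x ^+ k by rewrite exprn_ge0// ltW.
  rewrite [leRHS]ger0_norm; last by rewrite !mulr_ge0 ?h_ge0// invr_ge0 ltW.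
  rewrite normrM (ger0_norm xk0) mulrCA ler_wpM2l// [leRHS]mulrC.
  rewrite ler_pdivlMr// [leLHS]mulrC.
  by have := g_le x0; rewrite normrM gtr0_norm.
- exact: integrableZl.
Qed.

Lemma perturbed_moment s k :
  (\int[lebesgue_measure]_(x in `]0%R, +oo[) (x ^+ k * perturbed s x)%:E = (M k)%:E)%E.
Proof.
transitivity (\int[lebesgue_measure]_(x in `]0%R, +oo[)
  ((x ^+ k * h x)%:E + (s * k0)%:E * (x ^+ k * g x)%:E))%E.
  apply: eq_integral => x; rewrite inE/= in_itv/= andbT => x0.
  by rewrite perturbedE// -EFinM -EFinD; congr EFin; ring.
rewrite integralD//; last exact: integrableZl.
by rewrite h_moment integralZl// osc_cubert_moment// mule0 adde0.
Qed.

Lemma perturbed_probability s : `|s| <= 1 ->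
  exists nu : probability R R,
    [/\ forall A : set R, nu A = (\int[lebesgue_measure]_(x in A) (perturbed s x)%:E)%E,
        monomials_integrable nu &
        forall k, (\int[nu]_x (x ^+ k)%:E = (M k)%:E)%E].
Proof.
move=> s1.
have p0 x := perturbed_ge0 x s1.
have mp := measurable_perturbed s.
have carrier (f : R -> R) : measurable_fun setT f ->
    (forall x, x <= 0 -> f x = 0) -> (forall x, 0 <= f x) ->
  (\int[lebesgue_measure]_x (f x)%:E = \int[lebesgue_measure]_(x in `]0%R, +oo[) (f x)%:E)%E.
  move=> mf f_le0 f0; rewrite [RHS]integral_mkcond; apply: eq_integral => x _.
  rewrite patchE; case: ifPn => //; rewrite notin_setE/= in_itv/= andbT => /negP.
  by rewrite -leNgt => /f_le0 ->.
have [nu nuE] : exists nu : probability R R, forall A : set R,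
    nu A = (\int[lebesgue_measure]_(x in A) (perturbed s x)%:E)%E.
  apply: density_probability => //.
  rewrite carrier//; last exact: perturbed_le0.
  rewrite -M0 -(perturbed_moment s 0); apply: eq_integral => x _.
  by rewrite expr0 mul1r.
have norm_moment k : (\int[nu]_x (`|x| ^+ k)%:E = (M k)%:E)%E.
  have mX : measurable_fun setT (fun x : R => (`|x| ^+ k)%:E).
    by apply/measurable_EFinP; apply: measurable_funX; exact: normr_measurable.
  rewrite (ge0_integral_lebesgue_density mp p0 (fun A _ => nuE A) mX); last first.
    by move=> x; rewrite lee_fin exprn_ge0.
  rewrite -(perturbed_moment s k) -[LHS]/(\int[lebesgue_measure]_x (`|x| ^+ k * perturbed s x)%:E)%E.
  rewrite carrier.
  - apply: eq_integral => x; rewrite inE/= in_itv/= andbT => x0.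
    by rewrite gtr0_norm.
  - by apply: measurable_funM => //; apply: measurable_funX; exact: normr_measurable.
  - by move=> x x0; rewrite perturbed_le0// mulr0.
  - by move=> x; rewrite mulr_ge0// exprn_ge0.
exists nu; split => //.
- move=> k _; apply/integrableP; split.
    by apply/measurable_EFinP; exact: measurable_funX.
  under eq_integral do rewrite /= normrX.
  by rewrite norm_moment ltry.
- move=> k; rewrite -norm_moment.
  apply: (@integral_exprn_norm _ _ _ nu (fun x : R => x)) => //.
  rewrite preimage_id nuE integral0_eq// => x; rewrite /= in_itv/= => x0.
  by rewrite perturbed_le0// ltW.
Qed.

(** The two densities differ by 2 k0 g, which is positive where 2 B x^(1/3) is between
1 and 2. *)
Lemma perturbed_neq : exists2 A : set R, measurable A &
  (\int[lebesgue_measure]_(x in A) (perturbed 1 x)%:E !=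
   \int[lebesgue_measure]_(x in A) (perturbed (-1) x)%:E)%E.
Proof.
have [e e0 He] := osc_ge_cst R.
pose a : R := (2 * B)^-1 ^+ 3; pose c : R := (2 / (2 * B)) ^+ 3.
have a0 : 0 < a by rewrite exprn_gt0// invr_gt0.
have i0 : 0 < (2 * B)^-1 by rewrite invr_gt0.
have ac : a < c by rewrite ltrXn2r// ?nnegrE; lra.
have A_gt0 x : x \in `[a, c] -> 0 < x.
  by rewrite in_itv/= => /andP[ax _]; exact: lt_le_trans ax.
have A_sub : `[a, c] `<=` (`]0, +oo[ : set R).
  by move=> x /= /A_gt0; rewrite in_itv/= andbT.
have g_ge x : x \in `[a, c] -> e <= g x.
  rewrite in_itv/= => /andP[ax xc]; apply: He.
  have x0 : 0 < x by exact: lt_le_trans ax.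
  have lo : (2 * B)^-1 <= x `^ 3^-1.
    rewrite -[leLHS]cubert_cube; last exact: ltW.
    by apply: ge0_ler_powR; rewrite ?nnegrE ?invr_ge0// ltW.
  have hi : x `^ 3^-1 <= 2 / (2 * B).
    rewrite -[leRHS]cubert_cube; last by rewrite ltW// divr_gt0.
    apply: ge0_ler_powR; rewrite ?nnegrE ?invr_ge0//; first exact: ltW.
    by rewrite ltW// exprn_gt0// divr_gt0.
  apply/andP; split; first by rewrite -ler_pdivrMl// mulr1.
  by rewrite -ler_pdivlMl// mulrC.
exists [set` `[a, c]]; first exact: measurable_itv; apply/negP => /eqP E.
have p0 (s : R) x : `|s| <= 1 -> 0 <= perturbed s x by move=> ?; exact: perturbed_ge0.
have n1 : `|1 : R| <= 1 by rewrite normr1.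
have nN1 : `|-1 : R| <= 1 by rewrite normrN1.
have mp (s : R) : measurable_fun setT (fun x : R => (perturbed s x)%:E).
  by apply/measurable_EFinP.
have mg2 : measurable_fun setT (fun x : R => (2 * k0 * g x)%:E).
  by apply/measurable_EFinP; exact: measurable_funM.
have split_p : (\int[lebesgue_measure]_(x in `[a, c]) (perturbed 1 x)%:E =
    \int[lebesgue_measure]_(x in `[a, c]) (perturbed (-1) x)%:E +
    \int[lebesgue_measure]_(x in `[a, c]) (2 * k0 * g x)%:E)%E.
  rewrite -ge0_integralD//=.
  - apply: eq_integral => x; rewrite inE/= => /A_gt0 x0.
    by rewrite !perturbedE// -EFinD; congr EFin; ring.
  - by move=> x _; rewrite lee_fin p0.
  - by apply: measurable_funTS; exact: mp.
  - move=> x /g_ge gx; rewrite lee_fin mulr_ge0 ?(le_trans (ltW e0) gx)//.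
    by rewrite mulr_ge0// ltW.
  - by apply: measurable_funTS; exact: mg2.
have fin : (\int[lebesgue_measure]_(x in `[a, c]) (perturbed (-1) x)%:E \is a fin_num)%E.
  rewrite ge0_fin_numE; last by apply: integral_ge0 => x _; rewrite lee_fin p0.
  have := perturbed_moment (-1) 0; rewrite M0 => H.
  apply: (@le_lt_trans _ _ 1%E); last exact: ltry.
  rewrite -H; under [leRHS]eq_integral do rewrite expr0 mul1r.
  apply: ge0_subset_integral => //=.
  - by apply: measurable_funTS; exact: mp.
  - by move=> x _; rewrite lee_fin p0.
have : (0 < \int[lebesgue_measure]_(x in `[a, c]) (2 * k0 * g x)%:E)%E.
  apply: (@lt_le_trans _ _ (\int[lebesgue_measure]_(x in `[a, c]) (2 * k0 * e)%:E)%E).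
    rewrite integral_cst//= lebesgue_measure_itv/= lte_fin ac -EFinD -EFinM lte_fin.
    by rewrite !mulr_gt0// subr_gt0.
  apply: ge0_le_integral => //=.
  - by move=> x _; rewrite lee_fin !mulr_ge0// ltW.
  - by apply: measurable_funTS; exact: mg2.
  - by move=> x /g_ge gx; rewrite lee_fin ler_wpM2l// mulr_ge0// ltW.
have J0 : (\int[lebesgue_measure]_(x in `[a, c]) (2 * k0 * g x)%:E = 0)%E.
  have := split_p; rewrite E -[LHS]adde0 => /esym /(congr1 (fun z => (z - \int[lebesgue_measure]_(x in `[a, c]) (perturbed (-1) x)%:E)%E)).
  by rewrite adde0 addeAC subee// add0e.
by rewrite J0 ltxx.
Qed.

End Competitors.

(** * Mixtures of exponential laws *)

Lemma measurable_norm_inv (R : realType) : measurable_fun setT (fun x : R => `|x|^-1).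
Proof.
rewrite (_ : (fun _ => _) = fun x : R => `|x| `^ (-1)).
  by apply: (measurableT_comp (measurable_powR _)); exact: normr_measurable.
by apply/funext => x; rewrite powR_inv1.
Qed.

Section ExponentialMixture.
Context d (T : measurableType d) (R : realType) (P : probability T R) (W : T -> R).
Hypothesis mW : measurable_fun setT W.

(** The density at x of |W t| times a standard exponential variable. The absolute value
makes it a density for all t but those where W vanishes. *)
Definition mixture_kernel (t : T) (x : R) : R := `|W t|^-1 * expR (- (`|W t|^-1 * x)).

(** The density of |W| times a standard exponential variable independent of W. *)
Definition mixture_density (x : R) : R := fine (\int[P]_t (mixture_kernel t x)%:E)%E.

Lemma mixture_kernel_ge0 t x : 0 <= mixture_kernel t x.
Proof. by rewrite mulr_ge0 ?expR_ge0// invr_ge0. Qed.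

Lemma mixture_kernel_le t x : 0 < x -> mixture_kernel t x <= x^-1.
Proof.
move=> x0; rewrite /mixture_kernel; set u := `|W t|^-1.
rewrite expRN ler_pdivrMr ?expR_gt0// mulrC ler_pdivlMr//.
by rewrite (le_trans _ (expR_ge1Dx _))// lerDr.
Qed.

Let mrate : measurable_fun setT (fun t => `|W t|^-1).
Proof. exact: (measurableT_comp (@measurable_norm_inv R)). Qed.

Let mkernel : measurable_fun setT
  (fun z : T * measurableTypeR R => mixture_kernel z.1 z.2).
Proof.
have m1 : measurable_fun setT (fun z : T * measurableTypeR R => `|W z.1|^-1).
  exact: (measurableT_comp mrate).
apply: measurable_funM => //; apply: measurableT_comp => //.
by apply: measurableT_comp => //; exact: measurable_funM.
Qed.

Lemma measurable_mixture_kernel x : measurable_fun setT (fun t => (mixture_kernel t x)%:E).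
Proof.
apply/measurable_EFinP; apply: measurable_funM => //; apply: measurableT_comp => //.
by apply: measurableT_comp => //; exact: measurable_funM.
Qed.

Lemma mixture_densityE x : 0 < x ->
  (mixture_density x)%:E = (\int[P]_t (mixture_kernel t x)%:E)%E.
Proof.
move=> x0; rewrite fineK// ge0_fin_numE; last first.
  by apply: integral_ge0 => t _; rewrite lee_fin mixture_kernel_ge0.
apply: (@le_lt_trans _ _ (\int[P]_t (x^-1)%:E)%E); last first.
  by rewrite integral_probability_cst ltry.
apply: ge0_le_integral => //.
- by move=> t _; rewrite lee_fin mixture_kernel_ge0.
- exact: measurable_mixture_kernel.
- by move=> t _; rewrite lee_fin mixture_kernel_le.
Qed.

Lemma measurable_mixture_density : measurable_fun setT mixture_density.
Proof.
apply: (measurableT_comp (fine_measurable measurableT)).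
apply: (@measurable_fun_fubini_tonelli_G _ _ T (measurableTypeR R) R P
  (fun z : T * measurableTypeR R => (mixture_kernel z.1 z.2)%:E)).
- exact/measurable_EFinP.
- by move=> z; rewrite lee_fin mixture_kernel_ge0.
Qed.

(** By Tonelli, since the k-th moment of the exponential law of mean w is k! w^k. *)
Lemma mixture_density_moment k : P (W @^-1` [set 0]) = 0%E ->
  (\int[lebesgue_measure]_(x in `]0%R, +oo[) (x ^+ k * mixture_density x)%:E =
   (k`!%:R)%:E * \int[P]_t (`|W t| ^+ k)%:E)%E.
Proof.
move=> W0.
pose f (z : T * measurableTypeR R) : \bar R :=
  ((z.2 ^+ k * mixture_kernel z.1 z.2) * \1_(`]0, +oo[ : set R) z.2)%:E.
have mf : measurable_fun setT f.
  apply/measurable_EFinP; apply: measurable_funM; last first.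
    exact: (measurableT_comp (@measurable_indic _ (measurableTypeR R) R setT _ (measurable_itv _))).
  apply: measurable_funM => //; apply: measurable_funX; exact: measurable_snd.
have f0 z : (0 <= f z)%E.
  rewrite lee_fin indicE; case: (boolP (_ \in _)) => z0; rewrite ?mulr0// mulr1.
  rewrite mulr_ge0 ?mixture_kernel_ge0// exprn_ge0//.
  by move: z0; rewrite inE/= in_itv/= andbT => /ltW.
transitivity (\int[lebesgue_measure]_x (\int[P]_t f (t, x)))%E.
  rewrite integral_mkcond; apply: eq_integral => x _; rewrite patchE.
  case: ifPn => x0; last first.
    by rewrite integral0_eq// => t _; rewrite /f/= indicE (negbTE x0) mulr0.
  have {}x0' : 0 < x by move: x0; rewrite inE/= in_itv/= andbT.
  rewrite EFinM mixture_densityE// -ge0_integralZl//; last 3 first.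
  - exact: measurable_mixture_kernel.
  - by move=> t _; rewrite lee_fin mixture_kernel_ge0.
  - by rewrite lee_fin exprn_ge0// ltW.
  by apply: eq_integral => t _; rewrite /f/= indicE x0 mulr1 EFinM.
rewrite -(@fubini_tonelli _ _ T (measurableTypeR R) R P lebesgue_measure f)//.
rewrite -ge0_integralZl//; last first.
- by apply/measurable_EFinP; apply: measurable_funX; exact: measurableT_comp.
have mWk : measurable_fun setT (fun t => (`|W t| ^+ k)%:E).
  by apply/measurable_EFinP; apply: measurable_funX; exact: measurableT_comp.
apply: ae_eq_integral => //.
- exact: (@measurable_fun_fubini_tonelli_F _ _ T (measurableTypeR R) R lebesgue_measure f).
- exact: measurable_funeM.
exists (W @^-1` [set 0]); split => //.
  by rewrite -[X in measurable X]setTI; exact: mW.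
move=> t /= H; apply: contrapT => /eqP Wt; apply: H => _.
have r0 : 0 < `|W t|^-1 by rewrite invr_gt0 normr_gt0.
transitivity (\int[lebesgue_measure]_(x in `]0%R, +oo[)
    (x ^+ k * mixture_kernel t x)%:E)%E.
  rewrite [RHS]integral_mkcond; apply: eq_integral => x _; rewrite patchE /f/= indicE.
  by case: ifPn => _; rewrite ?mulr1// mulr0.
rewrite integral_itv_obnd_cbnd; last first.
  apply: measurable_funTS; apply/measurable_EFinP; apply: measurable_funM => //.
  by apply: measurable_funM => //; apply: measurableT_comp => //; apply: measurableT_comp => //.
by rewrite integral_gamma// exprVn invrK.
Qed.

End ExponentialMixture.

(** * Products of three variables *)

Section ProductIndeterminacy.
Context d (T : measurableType d) (R : realType) (P : probability T R).

Lemma light_tailed_moment (X : {RV P >-> R}) k : light_tailed P X ->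
  (\int[P]_w (`|X w| ^+ k)%:E < +oo)%E.
Proof.
move=> [c c0 Xc].
have mX : measurable_fun setT (fun w => `|X w|) by exact: measurableT_comp.
apply: (@le_lt_trans _ _ (\int[P]_w ((k`!%:R / c ^+ k)%:E * (expR (c * `|X w|))%:E))%E).
  apply: ge0_le_integral => //.
  - by apply/measurable_EFinP; exact: measurable_funX.
  - apply: measurable_funeM; apply/measurable_EFinP; apply: measurableT_comp => //.
    exact: measurable_funM.
  move=> w _; rewrite -EFinM lee_fin mulrAC ler_pdivlMr ?exprn_gt0//.
  rewrite -exprMn mulrC -ler_pdivrMl ?ltr0n ?fact_gt0// mulrC [_ * c]mulrC.
  have u0 : 0 <= c * `|X w| by rewrite mulr_ge0// ltW.
  case: k => [|k]; first by rewrite expr0 fact0 invr1 mulr1 -expR0 ler_expR.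
  by rewrite [leLHS]mulrC (le_trans _ (expR_ge1Dxn k u0))// lerDr.
rewrite ge0_integralZl//.
- by rewrite lte_mul_pinfty// lee_fin divr_ge0// exprn_ge0// ltW.
- apply/measurable_EFinP; apply: measurableT_comp => //.
  exact: measurable_funM.
- by rewrite lee_fin divr_ge0// exprn_ge0// ltW.
Qed.

Lemma exponential_moment (X : {RV P >-> R}) k : has_law P X (exponential_prob 1) ->
  (\int[P]_w (`|X w| ^+ k)%:E = (k`!%:R)%:E)%E.
Proof.
move=> law.
have mk : measurable_fun setT (fun x : R => (`|x| ^+ k)%:E).
  by apply/measurable_EFinP; apply: measurable_funX; exact: normr_measurable.
have k0 (x : R) : (0 <= (`|x| ^+ k)%:E)%E by rewrite lee_fin exprn_ge0.
rewrite -(ge0_integral_distribution X mk k0).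
rewrite (ge0_integral_lebesgue_density _ _ law mk k0); last 2 first.
- exact: measurable_exponential_pdf.
- by move=> x; exact: exponential_pdf_ge0.
rewrite -[RHS](_ : (k`!%:R / 1 ^+ k)%:E = _); last by rewrite expr1n divr1.
rewrite -integral_gamma//.
rewrite [RHS]integral_mkcond; apply: eq_integral => x _; rewrite patchE.
have [x0|x0] := leP 0 x.
  rewrite mem_set/= ?in_itv/= ?x0//.
  by rewrite exponential_pdfE// ger0_norm// mulNr.
by rewrite lt0_exponential_pdf// mule0 memNset//= in_itv/= andbT; apply/negP; rewrite -ltNge.
Qed.

Lemma independent_norm_moment (X Y : {RV P >-> R}) k :
  (forall A B : set R, measurable A -> measurable B ->
    P (X @^-1` A `&` Y @^-1` B) = (P (X @^-1` A) * P (Y @^-1` B))%E) ->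
  (\int[P]_w (`|(X \* Y) w| ^+ k)%:E =
   \int[P]_w (`|X w| ^+ k)%:E * \int[P]_w (`|Y w| ^+ k)%:E)%E.
Proof.
move=> indep.
have mk : measurable_fun setT (fun x : R => (`|x| ^+ k)%:E).
  by apply/measurable_EFinP; apply: measurable_funX; exact: normr_measurable.
rewrite -(ge0_integralM_independent indep mk mk).
- by apply: eq_integral => w _; rewrite -EFinM -exprMn -normrM.
- by move=> x; rewrite lee_fin exprn_ge0.
- by move=> x; rewrite lee_fin exprn_ge0.
Qed.

(** The least costly way for a product of three factors with exponential tails to be
of size x is that all of them be of size x^(1/3); only this event is kept. *)
Lemma mixture_density_ge (X Y : {RV P >-> R}) (k1 C1 k2 C2 : R) :
  (forall A B : set R, measurable A -> measurable B ->
    P (X @^-1` A `&` Y @^-1` B) = (P (X @^-1` A) * P (Y @^-1` B))%E) ->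
  0 < k1 -> 0 < k2 ->
  (forall s, 1 <= s -> ((k1 * expR (- (C1 * s)))%:E <= P (X @^-1` `[s, (s + 1)%R]))%E) ->
  (forall s, 1 <= s -> ((k2 * expR (- (C2 * s)))%:E <= P (Y @^-1` `[s, (s + 1)%R]))%E) ->
  forall x, 0 < x ->
    k1 * k2 * expR (- (2 + C1 + C2)) * expR (- ((3 + C1 + C2) * x `^ 3^-1)) <=
    mixture_density P (X \* Y) x.
Proof.
move=> indep k10 k20 HX HY x x0.
have mXY : measurable_fun setT (X \* Y) by exact: measurable_funM.
rewrite -lee_fin mixture_densityE//.
set t := x `^ 3^-1.
have t0 : 0 < t by exact: powR_gt0.
have xE : x = t ^+ 3 by rewrite cube_cubert// ltW.
(* The tail bounds of X and Y are available from 1 on, hence the shift by 1. *)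
pose s := t + 1.
have s1 : 1 <= s by rewrite lerDr ltW.
pose E := X @^-1` `[s, (s + 1)%R] `&` Y @^-1` `[s, (s + 1)%R].
have mE : measurable E.
  by apply: measurableI; exact: measurable_funPTI.
apply: (@le_trans _ _ (\int[P]_(w in E) (expR (- (3 * t + 2)))%:E)%E).
  rewrite integral_cst//.
  have -> : k1 * k2 * expR (- (2 + C1 + C2)) * expR (- ((3 + C1 + C2) * t)) =
     expR (- (3 * t + 2)) * (k1 * expR (- (C1 * s)) * (k2 * expR (- (C2 * s)))).
    rewrite [RHS](_ : _ = k1 * k2 * (expR (- (3 * t + 2)) * expR (- (C1 * s)) * expR (- (C2 * s)))); last by ring.
    by rewrite -!mulrA -!expRD; congr (_ * (_ * expR _)); rewrite /s; ring.
  have PE : P E = (P (X @^-1` `[s, (s + 1)%R]) * P (Y @^-1` `[s, (s + 1)%R]))%E.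
    by exact: indep.
  rewrite EFinM lee_wpmul2l ?lee_fin ?expR_ge0//.
  rewrite [leRHS]PE.
  by rewrite EFinM lee_pmul ?HX ?HY// lee_fin mulr_ge0 ?expR_ge0// ltW.
apply: (@le_trans _ _ (\int[P]_(w in E) (mixture_kernel (X \* Y) w x)%:E)%E); last first.
  apply: ge0_subset_integral => //.
  - exact: measurable_mixture_kernel.
  - by move=> w _; rewrite lee_fin mixture_kernel_ge0.
apply: ge0_le_integral => //.
- by apply: measurable_funTS; exact: measurable_mixture_kernel.
move=> w [/=]; rewrite !in_itv/= => /andP[sX Xs] /andP[sY Ys].
have s0 : 0 < s by exact: lt_le_trans s1.
(* On E, x / W <= t^3 / s^2 <= t and 1 / W >= (t + 2)^-2 >= exp (- 2 (t + 1)). *)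
have W_ge : s ^+ 2 <= X w * Y w by rewrite expr2 ler_pM// ltW.
have W_le : X w * Y w <= (s + 1) ^+ 2.
  by rewrite expr2 ler_pM// (le_trans (ltW s0)).
have W0 : 0 < X w * Y w by rewrite (lt_le_trans _ W_ge)// exprn_gt0.
rewrite lee_fin /mixture_kernel gtr0_norm//.
have -> : - (3 * t + 2) = - (t + 1) + - (t + 1) + - t by ring.
rewrite !expRD ler_pM ?expR_ge0 ?mulr_ge0 ?expR_ge0//.
  have H : expR (- (t + 1)) <= (s + 1)^-1.
    rewrite expRN lef_pV2 ?posrE ?expR_gt0//; last by rewrite addr_gt0.
    by rewrite addrC expR_ge1Dx.
  apply: (@le_trans _ _ ((s + 1)^-1 * (s + 1)^-1)); first by rewrite ler_pM ?expR_ge0.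
  rewrite -invfM -expr2 lef_pV2// posrE//.
  by rewrite exprn_gt0// addr_gt0.
rewrite ler_expR lerN2 ler_pdivrMl// xE exprSr ler_wpM2r// ?(ltW t0)//.
rewrite (le_trans _ W_ge)// lerXn2r// ?nnegrE ?(ltW t0) ?(ltW s0)//.
by rewrite lerDl.
Qed.

End ProductIndeterminacy.

(** The mixture density h attached to X Y has the moments of X Y Z, and so have its two
perturbations; if X Y Z were determinate, both would be its distribution. *)
Lemma product_moment_indeterminate d (T : measurableType d) (R : realType)
    (P : probability T R) (X Y Z : {RV P >-> R}) :
  independent3 P X Y Z ->
  P (X @^-1` `]-oo, 0]) = 0%E -> P (Y @^-1` `]-oo, 0]) = 0%E ->
  light_tailed P X -> light_tailed P Y ->
  (exists k C : R, [/\ 0 < k, 0 < C & forall s, 1 <= s ->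
    ((k * expR (- (C * s)))%:E <= P (X @^-1` `[s, (s + 1)%R]))%E]) ->
  (exists k C : R, [/\ 0 < k, 0 < C & forall s, 1 <= s ->
    ((k * expR (- (C * s)))%:E <= P (Y @^-1` `[s, (s + 1)%R]))%E]) ->
  has_law P Z (exponential_prob 1) ->
  moment_indeterminate P (X \* Y \* Z).
Proof.
move=> indep X0 Y0 lX lY [k1 [C1 [k10 C10 HX]]] [k2 [C2 [k20 C20 HY]]] law.
have indepXY := independent3_fst2 indep.
have indepW := independent3_mul indep.
pose W : {mfun T >-> R} := (X : {mfun T >-> R}) \* (Y : {mfun T >-> R}).
have mW : measurable_fun setT W by [].
pose V : T -> R := W \* Z.
have mV : measurable_fun setT V by exact: measurable_funM.
have mle0 (U : {RV P >-> R}) : measurable (U @^-1` `]-oo, 0]) by exact: measurable_funPTI.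
have mlt0 (U : {RV P >-> R}) : measurable (U @^-1` `]-oo, 0[) by exact: measurable_funPTI.
have null A : measurable A ->
    A `<=` (X @^-1` `]-oo, 0] `|` Y @^-1` `]-oo, 0]) `|` Z @^-1` `]-oo, 0[ -> P A = 0%E.
  move=> mA sA; apply: measure_negligible => //; apply: negligibleS sA _.
  apply: negligibleU; last by apply/negligibleP; [exact: mlt0|exact: exponential_lt0].
  by apply: negligibleU; apply/negligibleP.
have W0 : P (W @^-1` [set 0]) = 0%E.
  apply: null; first by rewrite -[X in measurable X]setTI; exact: mW.
  move=> w /= /eqP; rewrite mulf_eq0 => /orP[]/eqP E; left; [left|right].
    by rewrite /= in_itv/= E.
  by rewrite /= in_itv/= E.
have V0 : P (V @^-1` `]-oo, 0[) = 0%E.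
  apply: null; first by rewrite -[X in measurable X]setTI; exact: mV.
  move=> w /=; rewrite !in_itv/= => Vw.
  have [|Xw] := leP (X w) 0; first by left; left.
  have [|Yw] := leP (Y w) 0; first by left; right.
  by right; move: Vw; rewrite pmulr_rlt0// mulr_gt0.
pose M k := fine (\int[P]_w (`|V w| ^+ k)%:E)%E.
have Wfin k : (\int[P]_w (`|W w| ^+ k)%:E)%E \is a fin_num.
  rewrite ge0_fin_numE; last by apply: integral_ge0 => w _; rewrite lee_fin exprn_ge0.
  rewrite [ltLHS](independent_norm_moment k indepXY) lte_mul_pinfty//.
  - by apply: integral_ge0 => w _; rewrite lee_fin exprn_ge0.
  - rewrite ge0_fin_numE; first exact: light_tailed_moment.
    by apply: integral_ge0 => w _; rewrite lee_fin exprn_ge0.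
  - exact: light_tailed_moment.
have VE k : (\int[P]_w (`|V w| ^+ k)%:E = (k`!%:R)%:E * \int[P]_w (`|W w| ^+ k)%:E)%E.
  rewrite -(exponential_moment k law) muleC.
  exact: (@independent_norm_moment _ _ _ _ W Z k indepW).
have ME k : (\int[P]_w (`|V w| ^+ k)%:E)%E = (M k)%:E.
  by rewrite fineK// VE fin_numM.
have hM k : (\int[lebesgue_measure]_(x in `]0%R, +oo[) (x ^+ k * mixture_density P W x)%:E
    = (M k)%:E)%E.
  by rewrite mixture_density_moment// -VE ME.
have M0 : M 0 = 1.
  apply: EFin_inj; rewrite -ME; under eq_integral do rewrite expr0.
  exact: integral_probability_cst.
have Vfin : finite_moments P V.
  move=> k _; apply/integrableP; split.
    by apply/measurable_EFinP; exact: measurable_funX.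
  under eq_integral do rewrite /= normrX.
  by rewrite ME ltry.
split=> // -[_ det].
pose k0 := k1 * k2 * expR (- (2 + C1 + C2)).
pose B := 3 + C1 + C2.
have k00 : 0 < k0 by rewrite !mulr_gt0 ?expR_gt0.
have B0 : 0 < B by rewrite !addr_gt0.
have h_ge x : 0 < x -> k0 * expR (- (B * x `^ 3^-1)) <= mixture_density P W x.
  exact: (mixture_density_ge indepXY).
have mh := @measurable_mixture_density _ _ _ P W mW.
have [] := perturbed_neq mh hM M0 k00 B0 h_ge.
move=> A mA; apply/negP; rewrite negbK; apply/eqP.
have competitor s : `|s| <= 1 ->
    (\int[lebesgue_measure]_(x in A) (perturbed (mixture_density P W) k0 B s x)%:E =
     pushforward P V A)%E.
  move=> s1.
  have [nu [nuE nufin numom]] :=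
    perturbed_probability mh hM M0 k00 B0 h_ge s1.
  rewrite -nuE; apply: det => // k k_gt0.
  by rewrite /moment unlock numom integral_exprn_norm// ME.
by rewrite !competitor ?normrN1 ?normr1.
Qed.

(** * The products of inverse Gaussian and exponential variables *)

Theorem corollary2 (R : realType) (d : measure_display) (T : measurableType d)
    (P : probability T R) (xi1 xi2 eta : {RV P >-> R})
    (mu1 lambda1 mu2 lambda2 : R)
    (hmu1 : 0 < mu1) (hlambda1 : 0 < lambda1)
    (hmu2 : 0 < mu2) (hlambda2 : 0 < lambda2)
    (hxi1 : has_law P xi1 (inverse_gaussian_prob mu1 lambda1))
    (hxi2 : has_law P xi2 (inverse_gaussian_prob mu2 lambda2))
    (heta : has_law P eta (exponential_prob 1))
    (hindep : independent3 P xi1 xi2 eta) :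
  [/\ moment_determinate P (xi1 \* eta),
      moment_determinate P (xi1 \* xi2) &
      moment_indeterminate P (xi1 \* xi2 \* eta)].
Proof.
have lt0 (X : {RV P >-> R}) : P (X @^-1` `]-oo, 0]) = 0%E -> P (X @^-1` `]-oo, 0[) = 0%E.
  apply: subset_measure0; [exact: measurable_funPTI|exact: measurable_funPTI|].
  by move=> w /=; rewrite !in_itv/=; exact: ltW.
have le1 := inverse_gaussian_le0 hxi1; have le2 := inverse_gaussian_le0 hxi2.
have t1 := inverse_gaussian_light_tailed hmu1 hlambda1 hxi1.
have t2 := inverse_gaussian_light_tailed hmu2 hlambda2 hxi2.
have t3 := exponential_light_tailed heta.
split.
- exact: (product_moment_determinate (lt0 _ le1) (exponential_lt0 heta) t1 t3).
- exact: (product_moment_determinate (lt0 _ le1) (lt0 _ le2) t1 t2).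
- apply: (product_moment_indeterminate hindep le1 le2 t1 t2 _ _ heta).
    exact: inverse_gaussian_unit_itv hmu1 hlambda1 hxi1.
  exact: inverse_gaussian_unit_itv hmu2 hlambda2 hxi2.
Qed.
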